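(* Under Assumptions 1–3, assume $k_\ell<m_\ell n_\ell$ for all $\ell$. (i) If $0<\beta_1\le1$, $\tau\ge\frac{64}{3\beta_1\underline\delta}$ and $0<\eta\le\min\Big\{\frac1{4L},\sqrt{\frac{3\underline\delta\beta_1^2}{80L^2}},\sqrt{\frac{3\underline\delta}{80\tau^2L^2}},\sqrt{\frac{3\beta_1}{16\tau L^2}}\Big\}$, then GoSare with small-batch stochastic gradients and MSGD satisfies, for every integer $K\ge1$, $\frac1{K\tau}\sum_{t=0}^{K\tau-1}\mathbb{E}\|\nabla f(x^{(t)})\|_2^2\le\frac{16\Delta}{\underline\delta\eta K\tau}+\frac{32\beta_1\sigma^2}{3\underline\delta}$. (ii) If moreover $\Delta>0$, $T\ge2+128/(3\underline\delta)+(128\sigma)^2/(9\sqrt{\underline\delta}L\Delta)$ is an integer and one chooses $\beta_1=\big(1+\sqrt{\underline\delta^{3/2}\sigma^2T/(L\Delta)}\big)^{-1}$, $\tau=\lceil64/(3\underline\delta\beta_1)\rceil$, $\eta=\Big(4L+\sqrt{\tfrac{80L^2}{3\underline\delta\beta_1^2}}+\sqrt{\tfrac{80\tau^2L^2}{3\underline\delta}}+\sqrt{\tfrac{16\tau L^2}{3\beta_1}}\Big)^{-1}$, then $\frac1T\sum_{t=0}^{T-1}\mathbb{E}\|\nabla f(x^{(t)})\|_2^2\le C\Big(\frac{L\Delta}{\underline\delta^{5/2}T}+\sqrt{\frac{L\Delta\sigma^2}{\underline\delta^{7/2}T}}\Big)$ for an absolute constant $C$.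
   Context: Parameters $x=(\mathrm{vec}(X_1)^\top,\dots,\mathrm{vec}(X_{N_L})^\top)^\top\in\mathbb{R}^d$, $X_\ell\in\mathbb{R}^{m_\ell\times n_\ell}$; $f(x)=\mathbb{E}_{\xi\sim\mathcal D}F(x;\xi)$; $\nabla_\ell$ is the gradient w.r.t. $X_\ell$. Assumption 1: $\inf f>-\infty$. Assumption 2: $\nabla f$ is $L$-Lipschitz in $\|\cdot\|_2$. Assumption 3: $\mathbb{E}_\xi[\nabla_\ell F(x;\xi)]=\nabla_\ell f(x)$, $\mathbb{E}_\xi\|\nabla_\ell F(x;\xi)-\nabla_\ell f(x)\|_F^2\le\sigma_\ell^2$; $\sigma^2=\sum_\ell\sigma_\ell^2$. $\Delta=f(x^{(0)})-\inf f$, $\delta_\ell=k_\ell/(m_\ell n_\ell)$, $\underline\delta=\min_\ell\delta_\ell$. $\mathrm{Sp}_{m,n}^k=\{S\in\{0,1\}^{m\times n}:\|S\|_F^2=k\}$. GoSare with MSGD: $M_\ell^{(-1)}=0$. For $t\ge0$ draw $\xi^{(t)}\sim\mathcal D$ independently, $G_\ell^{(t)}=\nabla_\ell F(x^{(t)};\xi^{(t)})$; if $t\equiv0\pmod\tau$, sample $S_\ell^{(t)}$ uniformly from $\mathrm{Sp}_{m_\ell,n_\ell}^{k_\ell}$ independently of everything else, otherwise $S_\ell^{(t)}=S_\ell^{(t-1)}$; $M_\ell^{(t)}=(1-\beta_1)S_\ell^{(t)}\odot M_\ell^{(t-1)}+\beta_1S_\ell^{(t)}\odot G_\ell^{(t)}$;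 $X_\ell^{(t+1)}=X_\ell^{(t)}-\eta S_\ell^{(t)}\odot M_\ell^{(t)}$ ($\odot$ = entrywise product). *)

(* Defs.v *)
From HB Require Import structures.
From mathcomp Require Import all_boot all_order all_algebra.
From mathcomp Require Import all_classical all_reals all_analysis.
Set Implicit Arguments. Unset Strict Implicit. Unset Printing Implicit Defensive.
Import Order.TTheory GRing.Theory Num.Theory.
Import numFieldNormedType.Exports.
Local Open Scope classical_set_scope.
Local Open Scope ring_scope.

(* Coordinates of x = (vec X_1, ..., vec X_{N_L}) : an entry (i,j) of layer l. *)
Definition pcoord (NL : nat) (m n : 'I_NL -> nat) : finType :=
  {l : 'I_NL & ('I_(m l) * 'I_(n l))%type}.

Section Defs.
Variable R : realType.

Definition normsq (I : finType) (v : I -> R) : R := \sum_(i : I) v i ^+ 2.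

Definition layer_normsq NL (m n : 'I_NL -> nat) (l : 'I_NL)
  (v : pcoord m n -> R) : R := \sum_(i : pcoord m n | tag i == l) v i ^+ 2.

Definition is_gradient (I : finType) (h : (I -> R) -> R) (g : (I -> R) -> I -> R)
  : Prop :=
  forall x v : I -> R,
    (fun t : R => (h (fun i => x i + t * v i) - h x) / t) @ (0 : R)^'
      --> \sum_(i : I) g x i * v i.

Definition Assumption1 (I : finType) (f : (I -> R) -> R) : Prop :=
  has_lbound (range f).

Definition Assumption2 (I : finType) (gradf : (I -> R) -> I -> R) (L : R) : Prop :=
  forall x y : I -> R,
    Num.sqrt (normsq (fun i => gradf x i - gradf y i))
      <= L * Num.sqrt (normsq (fun i => x i - y i)).

Definition StochObjective (d : measure_display) (Xi : measurableType d)
  (D : probability Xi R) (I : finType) (f : (I -> R) -> R)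
  (F : (I -> R) -> Xi -> R) (G : (I -> R) -> Xi -> I -> R) : Prop :=
  (forall x, D.-integrable setT (fun z => (F x z)%:E) /\
             (f x)%:E = (\int[D]_z (F x z)%:E)%E) /\
  (forall z, is_gradient (fun x => F x z) (fun x => G x z)).

Definition Assumption3 (d : measure_display) (Xi : measurableType d)
  (D : probability Xi R) NL (m n : 'I_NL -> nat)
  (G : (pcoord m n -> R) -> Xi -> pcoord m n -> R)
  (gradf : (pcoord m n -> R) -> pcoord m n -> R) (sig : 'I_NL -> R) : Prop :=
  (forall x i, D.-integrable setT (fun z => (G x z i)%:E) /\
               (\int[D]_z (G x z i)%:E = (gradf x i)%:E)%E) /\
  (forall l, 0 <= sig l) /\
  (forall x l,
     (\int[D]_z (layer_normsq l (fun i => G x z i - gradf x i))%:E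
        <= (sig l ^+ 2)%:E)%E).

(* (x, xi) |-> G(x; xi) is jointly (Borel x Xi)-measurable, phrased as:
   it maps measurable random inputs to measurable random outputs. *)
Definition jointly_measurable (d : measure_display) (Xi : measurableType d)
  (I : finType) (G : (I -> R) -> Xi -> I -> R) : Prop :=
  forall (d' : measure_display) (T : measurableType d') (X : I -> T -> R)
         (Y : T -> Xi),
    (forall i, measurable_fun setT (X i)) -> measurable_fun setT Y ->
    forall j, measurable_fun setT (fun w => G (fun i => X i w) (Y w) j).

Definition sigma2 NL (sig : 'I_NL -> R) : R := \sum_(l < NL) sig l ^+ 2.

Definition delta NL (m n k : 'I_NL -> nat) (l : 'I_NL) : R :=
  (k l)%:R / (m l * n l)%:R.

(* underline delta = min_l delta_l  (each delta_l <= 1, so the seed 1 is harmless) *)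
Definition delta_min NL (m n k : 'I_NL -> nat) : R :=
  \big[Num.min/1]_(l < NL) delta m n k l.

Definition Delta (I : finType) (f : (I -> R) -> R) (x0 : I -> R) : R :=
  f x0 - inf (range f).

(* the product set Sp^{k_1}_{m_1,n_1} x ... x Sp^{k_NL}_{m_NL,n_NL} of masks *)
Definition masks NL (m n k : 'I_NL -> nat) : {set {ffun pcoord m n -> bool}} :=
  [set S : {ffun pcoord m n -> bool} |
     [forall l : 'I_NL, #|[set i : pcoord m n | (tag i == l) && S i]| == k l]].

(* uniform probability on the mask set (= independent uniform masks per layer) *)
Definition unif_mask NL (m n k : 'I_NL -> nat) (B : {set {ffun pcoord m n -> bool}}) : R :=
  #|B :&: masks m n k|%:R / #|masks m n k|%:R.

(* The randomness of the algorithm on a probability space (Om, P):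
   xi t = xi^(t) ~ D, U j = the masks sampled at iteration t = j * tau
   (uniform on masks), all of them mutually independent. *)
Definition sampling_model (d : measure_display) (Xi : measurableType d)
  (D : probability Xi R) NL (m n k : 'I_NL -> nat)
  (dO : measure_display) (Om : measurableType dO) (P : probability Om R)
  (xi : nat -> Om -> Xi) (U : nat -> Om -> {ffun pcoord m n -> bool}) : Prop :=
  (forall t, measurable_fun setT (xi t)) /\
  (forall j s, measurable (U j @^-1` [set s])) /\
  (forall (N : nat) (A : nat -> set Xi) (B : nat -> {set {ffun pcoord m n -> bool}}),
     (forall t, measurable (A t)) ->
     P (\bigcap_(t in `I_N) (xi t @^-1` A t `&` U t @^-1` [set s | s \in B t]))
       = (\prod_(t < N) (fine (D (A t)) * unif_mask k (B t)))%:E).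

(* GoSare with MSGD.  gosare_state t = (x^(t), M^(t-1)), with M^(-1) = 0.
   S^(t) = U (t %/ tau): resampled when t = 0 mod tau, kept otherwise. *)
Fixpoint gosare_state (Xi Om : Type) (I : finType)
  (G : (I -> R) -> Xi -> I -> R) (xi : nat -> Om -> Xi)
  (U : nat -> Om -> {ffun I -> bool}) (x0 : I -> R) (beta eta : R) (tau : nat)
  (w : Om) (t : nat) : (I -> R) * (I -> R) :=
  match t with
  | 0 => (x0, fun _ => 0)
  | t'.+1 =>
      let xM := gosare_state G xi U x0 beta eta tau w t' in
      let S := U (t' %/ tau)%N w in
      let g := G xM.1 (xi t' w) in
      let M' := fun i => (1 - beta) * (S i : nat)%:R * xM.2 i
                         + beta * (S i : nat)%:R * g i in
      (fun i => xM.1 i - eta * (S i : nat)%:R * M' i, M')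
  end.

Definition gosare_x (Xi Om : Type) (I : finType)
  (G : (I -> R) -> Xi -> I -> R) (xi : nat -> Om -> Xi)
  (U : nat -> Om -> {ffun I -> bool}) (x0 : I -> R) (beta eta : R) (tau : nat)
  (t : nat) (w : Om) : I -> R :=
  (gosare_state G xi U x0 beta eta tau w t).1.

Definition Egradsq (dO : measure_display) (Om : measurableType dO)
  (P : probability Om R) (I : finType) (gradf : (I -> R) -> I -> R)
  (X : Om -> I -> R) : \bar R :=
  (\int[P]_w (normsq (gradf (X w)))%:E)%E.

End Defs.

Arguments delta {R NL}.
Arguments delta_min {R NL}.

(* Main.v *)
(** The momentum error splits along the mask,
    |M - g|^2 = |S(M - g)|^2 + |(1 - S)g|^2, where g is the gradient at x^(t).
    On the mask, conditioning on everything but xi^(t) gives the recursion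
    E e_t <= (1 - beta) E e_(t-1) + L^2/beta E|x^(t) - x^(t-1)|^2
    + beta^2 sigma^2, plus E|g|^2 whenever a new mask is drawn; summed over t,
    the last term only costs a fraction 1/(beta tau) of sum_t E|g|^2, which is
    why tau has to be large.  Off the mask, a fresh mask is independent of
    x^(j tau) and keeps each coordinate of layer l with probability delta_l, so
    E|(1 - S)g|^2 <= (1 - delta) E|g|^2 at the start of a block, and the drift
    of g inside a block is controlled by the steps.  Both bounds enter the
    descent inequality, in which the negative multiple of sum_t |x^(t+1) - x^(t)|^2
    absorbs all drift terms.  The second part takes K = floor(T/tau) + 1, with
    T <= K tau <= 2 T. *)

Require Import Defs.
From HB Require Import structures.
From mathcomp Require Import all_boot all_order all_algebra.
From mathcomp Require Import all_classical all_reals all_analysis.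
From mathcomp Require Import measurable_realfun perm ring lra.
Set Implicit Arguments. Unset Strict Implicit. Unset Printing Implicit Defensive.
Import Order.TTheory GRing.Theory Num.Theory.
Import numFieldNormedType.Exports.
Local Open Scope classical_set_scope.
Local Open Scope ring_scope.

(** * Independence of the past and a fresh sample *)

(** No conditional expectation is formed. [Om] is given the coarser sigma-algebra generated by all
    samples except one, the identity is a random variable into that space, and Tonelli on the
    product law integrates out the excluded sample. The obstacle is that a mask is kept for [tau]
    steps: inside a block x^(t) depends on the mask, so the marginal delta_l can be used at block
    starts only. Drift carries the bound to the rest of the block, and drift again compares the
    gradients at block starts with all gradients; each costs about tau^2 / 2 times the squared
    steps, hence the constraint on tau L eta. The expectations are extended reals that no hypothesis
    makes finite, so integrability along the run is proved by induction before the recursions become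
    real inequalities. The Young weight delta/4 is small enough to be paid twice against the factor
    1 - delta; the share delta/8 of the gradient sum that is kept produces the constant 16. *)

(* The law of (X, Y) is the product law, since both agree on the rectangles
   whose first side lies in the pi-system C. *)
Section Independence.
Local Open Scope ereal_scope.
Context (R : realType) (d d1 d2 : measure_display) (T : measurableType d)
  (T1 : measurableType d1) (T2 : measurableType d2) (P : probability T R)
  (Q : probability T2 R) (X : T -> T1) (Y : T -> T2) (C : set (set T1)).
Hypothesis mX : measurable_fun setT X.
Hypothesis mY : measurable_fun setT Y.
Hypothesis Cgen : d1.-measurable = <<s C >>.
Hypothesis CI : setI_closed C.
Hypothesis CT : C setT.
Hypothesis XY : forall A B, C A -> measurable B ->
  P (X @^-1` A `&` Y @^-1` B) = P (X @^-1` A) * Q B.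

Lemma indep_tonelli (H : T1 * T2 -> \bar R) :
  measurable_fun setT H -> (forall x, 0 <= H x) ->
  \int[P]_w H (X w, Y w) = \int[P]_w \int[Q]_y H (X w, y).
Proof.
move=> mH H0.
pose X' : {mfun T >-> T1} := HB.pack X (isMeasurableFun.Build _ _ _ _ _ mX).
have mXY : measurable_fun setT (fun w => (X w, Y w)).
  exact: measurable_fun_pair.
have mF : measurable_fun setT (fubini_F Q H).
  exact: measurable_fun_fubini_tonelli_F.
transitivity (\int[pushforward P (fun w => (X w, Y w))]_z H z).
  by rewrite ge0_integral_pushforward.
transitivity (\int[distribution P X' \x Q]_z H z).
  apply: eq_measure_integral => /= A mA _.
  pose XY' : {mfun T >-> (T1 * T2)%type} :=
    HB.pack (fun w => (X w, Y w)) (isMeasurableFun.Build _ _ _ _ _ mXY).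
  apply/esym/(product_measure_unique (m' := distribution P XY')) => //.
  move=> A1 B mA1 mB.
  change (P (X @^-1` A1 `&` Y @^-1` B) = P (X @^-1` A1) * Q B).
  have mYB : d.-measurable (Y @^-1` B).
    by rewrite -[X in measurable X]setTI; exact: mY.
  have QBfin : Q B \is a fin_num by rewrite fin_num_measure.
  have QB0 : (0 <= fine (Q B))%R by exact: fine_ge0.
  (* For fixed [B] both sides are finite measures in the first argument, so agreement on the
     pi-system [C] suffices. *)
  pose m1 : {measure set T1 -> \bar R} :=
    measure_function_pushforward__canonical__measure_function_Measure
      (mrestr P mYB) mX.
  pose m3 : {measure set T1 -> \bar R} :=
    mscale (NngNum QB0) (distribution P X').
  have : forall E, measurable E -> m1 E = m3 E.
    apply: (measure_unique C (fun=> setT)) => //.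
    - by rewrite bigcup_const.
    - move=> E CE.
      change (P (X @^-1` E `&` Y @^-1` B) = (fine (Q B))%:E * P (X @^-1` E)).
      by rewrite XY// muleC fineK.
    - move=> k; change (P (X @^-1` setT `&` Y @^-1` B) < +oo).
      rewrite preimage_setT setTI.
      by rewrite (le_lt_trans (probability_le1 _ _))// ltry.
  move=> /(_ A1 mA1).
  change (P (X @^-1` A1 `&` Y @^-1` B) = (fine (Q B))%:E * P (X @^-1` A1) ->
    P (X @^-1` A1 `&` Y @^-1` B) = P (X @^-1` A1) * Q B).
  by move=> ->; rewrite fineK// muleC.
rewrite fubini_tonelli1// ge0_integral_distribution//.
by move=> y; apply: integral_ge0.
Qed.
End Independence.

Lemma measurable_finType_preimage d (T : measurableType d) (F : finType)
    (V : T -> F) (B : set F) :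
  (forall s, measurable (V @^-1` [set s])) -> measurable (V @^-1` B).
Proof.
move=> mV; rewrite (_ : V @^-1` B = \bigcup_(s in B) V @^-1` [set s]).
  by apply: fin_bigcup_measurable => //; exact: finite_finset.
by apply/seteqP; split => [w wB|w [s sB /= ws]] /=; [exists (V w)|rewrite ws].
Qed.

(** * Cylinder events and the sigma-algebras they generate *)

Section Sampling.
Context (R : realType) (dX : measure_display) (Xi : measurableType dX)
  (D : probability Xi R) (NL : nat) (m n k : 'I_NL -> nat)
  (dO : measure_display) (Om : measurableType dO) (P : probability Om R)
  (xi : nat -> Om -> Xi) (U : nat -> Om -> {ffun pcoord m n -> bool}).
Hypothesis HS : sampling_model D k P xi U.

Let mxi t : measurable_fun setT (xi t). Proof. by case: HS. Qed.

Lemma measurable_mask_preimage j (B : {set {ffun pcoord m n -> bool}}) :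
  measurable (U j @^-1` [set s | s \in B]).
Proof.
by apply: measurable_finType_preimage => s; case: HS => _ [].
Qed.

Definition cyl (N : nat) (A : nat -> set Xi)
    (B : nat -> {set {ffun pcoord m n -> bool}}) : set Om :=
  \bigcap_(t in `I_N) (xi t @^-1` A t `&` U t @^-1` [set s | s \in B t]).

(* Cylinders that leave xi^(t) free unless [a t] and the t-th mask free unless
   [b t]: a pi-system generating the information in the other samples. *)
Definition cyls (N : nat) (a b : pred nat) : set (set Om) :=
  [set E | exists A B, [/\ forall t, measurable (A t),
    forall t, ~~ a t -> A t = setT, forall t, ~~ b t -> B t = [set: _]%SET &
    E = cyl N A B]].

Lemma cyl_measurable N A B : (forall t, measurable (A t)) ->
  measurable (cyl N A B).
Proof.
move=> mA; apply: bigcap_measurableType => t _.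
apply: measurableI; last exact: measurable_mask_preimage.
by rewrite -[X in measurable X]setTI; exact: mxi.
Qed.

Lemma cyls_measurable N a b : cyls N a b `<=` measurable.
Proof. by move=> _ [A [B [mA _ _ ->]]]; exact: cyl_measurable. Qed.

Lemma cyls_setT N a b : cyls N a b setT.
Proof.
exists (fun=> setT), (fun=> [set: _]%SET); split => //.
by apply/esym/seteqP; split => // w _ t _; split => //=; rewrite finset.in_setT.
Qed.

Lemma cylI N A B A' B' : cyl N A B `&` cyl N A' B' =
  cyl N (fun t => A t `&` A' t) (fun t => B t :&: B' t).
Proof.
apply/seteqP; split => [w [H1 H2] t tN|w H].
  have [h1 h2] := H1 t tN; have [h3 h4] := H2 t tN.
  by split => //=; rewrite inE; apply/andP.
by split => t tN; have [[h1 h2] /=] := H t tN; rewrite inE => /andP[].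
Qed.

Lemma cyls_setI N a b : setI_closed (cyls N a b).
Proof.
move=> _ _ [A [B [mA aA bB ->]]] [A' [B' [mA' aA' bB' ->]]].
rewrite cylI; exists (fun t => A t `&` A' t), (fun t => B t :&: B' t)%SET.
split => [t|t ?|t ?|//].
- exact: measurableI.
- by rewrite aA// aA'// setTI.
- by rewrite bB// bB'// finset.setTI.
Qed.

Lemma cyl_prob N A B : (forall t, measurable (A t)) ->
  P (cyl N A B) = (\prod_(t < N) (fine (D (A t)) * unif_mask R k (B t)))%:E.
Proof. by case: HS => _ [_]; exact. Qed.

(** With no admissible mask [unif_mask] would divide by zero, hence be 0, and the sure event would
    get probability 0. *)
Lemma masks_neq0 : (#|masks m n k|%:R : R) != 0.
Proof.
have := @cyl_prob 1 (fun=> setT) (fun=> [set: _]%SET) (fun=> measurableT).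
rewrite (_ : cyl _ _ _ = setT); last first.
  by apply/seteqP; split => // w _ t _; split => //=; rewrite finset.in_setT.
rewrite probability_setT big_ord1 /unif_mask; apply: contra_eqN => /eqP ->.
by rewrite invr0 !mulr0 eqe oner_neq0.
Qed.

Lemma unif_mask_setT : unif_mask R k [set: {ffun pcoord m n -> bool}]%SET = 1.
Proof. by rewrite /unif_mask finset.setTI divff// masks_neq0. Qed.

(** Both are [Om] with fewer events. For N = t + 1, [xi_past] knows the earlier gradient samples and
    every mask up to index t, hence x^(t), M^(t-1) and the current mask; [U_past] omits one mask and
    keeps all gradient samples below N. *)
Definition xi_past N t := g_sigma_algebraType (cyls N (predC1 t) predT).
Definition U_past N j := g_sigma_algebraType (cyls N predT (predC1 j)).

(** Constraining a sample that [E] leaves free only changes one factor of the product formula, from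
    1 to the probability of [A]. *)
Lemma cyls_xi_indep N t (E : set Om) (A : set Xi) : (t < N)%N ->
  cyls N (predC1 t) predT E -> measurable A ->
  P (E `&` xi t @^-1` A) = (P E * D A)%E.
Proof.
move=> tN [A0 [B0 [mA0 aA0 _ ->]]] mA.
have A0t : A0 t = setT by apply: aA0 => /=; rewrite eqxx.
pose A1 s := if s == t then A else A0 s.
have -> : cyl N A0 B0 `&` xi t @^-1` A = cyl N A1 B0.
  apply/seteqP; split => [w [H1 H2] s sN|w H1].
    have [h1 h2] := H1 s sN; split => //=.
    by rewrite /A1; case: eqP => [->|].
  split=> [s sN|].
    have [] := H1 s sN; rewrite /A1; case: eqP => [->|//] /= h1 h2.
    by split => //=; rewrite A0t.
  by have [] := H1 t tN; rewrite /A1 eqxx.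
have mA1 s : measurable (A1 s) by rewrite /A1; case: ifP.
rewrite !cyl_prob// (bigD1 (Ordinal tN))//= [X in (_ = X%:E * _)%E](bigD1 (Ordinal tN))//=.
rewrite {1}/A1 eqxx A0t probability_setT mul1r -[D A]fineK ?fin_num_measure//.
rewrite -EFinM; congr EFin; rewrite -mulrA mulrC; congr (_ * _ * _).
apply: eq_bigr => i it; rewrite /A1 (_ : (i : nat) == t = false)//.
exact: negbTE it.
Qed.

Lemma cyls_U_indep N t (E : set Om) (B : {set {ffun pcoord m n -> bool}}) :
  (t < N)%N -> cyls N predT (predC1 t) E ->
  P (E `&` U t @^-1` [set s | s \in B]) = (P E * (unif_mask R k B)%:E)%E.
Proof.
move=> tN [A0 [B0 [mA0 _ aB0 ->]]].
have B0t : B0 t = [set: _]%SET by apply: aB0 => /=; rewrite eqxx.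
pose B1 s := if s == t then B else B0 s.
have -> : cyl N A0 B0 `&` U t @^-1` [set s | s \in B] = cyl N A0 B1.
  apply/seteqP; split => [w [H1 H2] s sN|w H1].
    have [h1 h2] := H1 s sN; split => //=.
    by rewrite /B1; case: eqP => [->|].
  split=> [s sN|].
    have [] := H1 s sN; rewrite /B1; case: eqP => [->|//] /= h1 h2.
    by split => //=; rewrite B0t finset.in_setT.
  by have [] := H1 t tN; rewrite /B1 eqxx.
rewrite !cyl_prob// (bigD1 (Ordinal tN))//= [X in (_ = X%:E * _)%E](bigD1 (Ordinal tN))//=.
rewrite {1}/B1 eqxx B0t unif_mask_setT mulr1.
rewrite -EFinM; congr EFin; rewrite mulrAC; congr (_ * _ * _).
apply: eq_bigr => i it; rewrite /B1 (_ : (i : nat) == t = false)//.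
exact: negbTE it.
Qed.

Lemma measurable_xi_cyls N (a b : pred nat) t : (t < N)%N -> a t ->
  measurable_fun (setT : set (g_sigma_algebraType (cyls N a b))) (xi t).
Proof.
move=> tN at_ _ A mA; rewrite setTI; apply: sub_sigma_algebra.
exists (fun s => if s == t then A else setT), (fun=> [set: _]%SET); split => //.
- by move=> s; case: ifP.
- by move=> s; case: eqP => [->|//]; rewrite at_.
- apply/seteqP; split => [w wA s sN|w /(_ t tN)[]].
    by split; [case: eqP => // -> |rewrite /= finset.in_setT].
  by rewrite eqxx.
Qed.

Lemma measurable_U_cyls N (a b : pred nat) t s : (t < N)%N -> b t ->
  measurable (U t @^-1` [set s] : set (g_sigma_algebraType (cyls N a b))).
Proof.
move=> tN bt; apply: sub_sigma_algebra.
exists (fun=> setT), (fun r => if r == t then [set s]%SET else [set: _]%SET); split => //.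
- by move=> r; case: eqP => [->|//]; rewrite bt.
- apply/seteqP; split => [w /= ws r rN|w /(_ t tN)[_]].
    by split => //=; case: eqP => [->|_]; rewrite inE// ws.
  by rewrite /= eqxx inE => /eqP.
Qed.

Lemma measurable_id_cyls N a b :
  measurable_fun (setT : set Om) (id : Om -> g_sigma_algebraType (cyls N a b)).
Proof.
move=> _ A; rewrite setTI; apply: smallest_sub => //.
  exact: sigma_algebra_measurable.
exact: cyls_measurable.
Qed.

End Sampling.

(** * Marginals of the uniform mask *)

Lemma card_layer NL (m n : 'I_NL -> nat) (l : 'I_NL) :
  #|[set i : pcoord m n | tag i == l]%SET| = (m l * n l)%N.
Proof.
have -> : [set i : pcoord m n | tag i == l]%SET =
    [set Tagged (fun l => ('I_(m l) * 'I_(n l))%type) p | p : 'I_(m l) * 'I_(n l)]%SET.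
  apply/setP => -[l' p]; rewrite inE /=; apply/eqP/imsetP => [e|[q _ e]].
    by subst l'; exists p.
  exact: (congr1 tag e).
rewrite card_imset ?card_prod ?card_ord// => p q /eqP.
by rewrite eq_Tagged => /eqP.
Qed.

Section Marginal.
Context (NL : nat) (m n k : 'I_NL -> nat).

Let swap (i j : pcoord m n) (s : {ffun pcoord m n -> bool}) :
  {ffun pcoord m n -> bool} := [ffun x => s (tperm i j x)].

Let swapK i j : involutive (swap i j).
Proof. by move=> s; apply/ffunP => x; rewrite !ffunE tpermK. Qed.

(* In [masks] the inner comprehension is a classical set; this is its finite
   counterpart. *)
Lemma mem_masks (s : {ffun pcoord m n -> bool}) : (s \in masks m n k) =
  [forall l, #|[set i : pcoord m n | (tag i == l) && s i]%SET| == k l].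
Proof.
rewrite inE; apply: eq_forallb => l; congr (_ == k l); apply: eq_card => i.
by rewrite [RHS]inE; apply/idP/idP => [/set_mem|?]; [|exact/mem_set].
Qed.

Let masks_swap i j s : tag i = tag j ->
  (swap i j s \in masks m n k) = (s \in masks m n k).
Proof.
move=> ij; rewrite !mem_masks; apply: eq_forallb => l; congr (_ == k l).
rewrite -[RHS](card_preimset _ (@perm_inj _ (tperm i j))).
apply: eq_card => x; rewrite !inE ffunE.
by case: tpermP => [->|->|]; rewrite ?ij.
Qed.

(** Exchanging two coordinates of one layer is an involution of the mask set. *)
Lemma card_masks_swap i j : tag i = tag j ->
  #|[set s : {ffun pcoord m n -> bool} | s i]%SET :&: masks m n k| =
  #|[set s : {ffun pcoord m n -> bool} | s j]%SET :&: masks m n k|.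
Proof.
move=> ij; rewrite -[LHS](card_preimset _ (inv_inj (swapK i j))).
apply: eq_card => s; rewrite [LHS]inE !finset.in_setI masks_swap//.
by congr (_ && _); rewrite [LHS]inE [RHS]inE ffunE tpermL.
Qed.

Lemma unif_mask_coord (R : realType) (i : pcoord m n) :
  (0 < m (tag i) * n (tag i))%N -> (#|masks m n k|%:R : R) != 0 ->
  unif_mask R k [set s : {ffun pcoord m n -> bool} | s i]%SET = delta m n k (tag i).
Proof.
move=> mn0 M0; rewrite /unif_mask /delta.
set c := #|_ :&: _|; set l := tag i.
(* Double counting of pairs (mask, coordinate of layer [l] that it keeps): by symmetry each
   coordinate lies in [c] masks, and each mask keeps [k l] coordinates. *)
have E : (c * (m l * n l) = k l * #|masks m n k|)%N.
  transitivity (\sum_(j in [set j : pcoord m n | tag j == l]%SET) c)%N.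
    by rewrite sum_nat_const card_layer mulnC.
  transitivity (\sum_(j in [set j : pcoord m n | tag j == l]%SET)
      \sum_(s in masks m n k) (s j : nat))%N.
    apply: eq_bigr => j; rewrite inE => /eqP jl.
    rewrite /c (@card_masks_swap i j)// -sum1_card big_mkcond [RHS]big_mkcond/=.
    by apply: eq_bigr => s _; rewrite finset.in_setI inE; case: (s j); case: (s \in _).
  rewrite exchange_big/= mulnC -sum_nat_const; apply: eq_bigr => s.
  rewrite mem_masks => /forallP/(_ l)/eqP <-.
  rewrite -sum1_card big_mkcond [RHS]big_mkcond/=.
  by apply: eq_bigr => j _; rewrite !inE; case: (s j); case: (tag j == l).
have mnR : ((m l * n l)%:R : R) != 0 by rewrite pnatr_eq0 -lt0n.
by apply/eqP; rewrite eqr_div// -!natrM E.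
Qed.
End Marginal.

(** * Descent inequality *)

Section Descent.
Context (R : realType) (I : finType).
Implicit Types (f : (I -> R) -> R) (g : (I -> R) -> I -> R) (x y v : I -> R).

Lemma normsq_ge0 v : 0 <= normsq v.
Proof. by apply: sumr_ge0 => i _; exact: sqr_ge0. Qed.

Lemma lipschitz_normsq g (L : R) : 0 <= L -> Assumption2 g L -> forall x y,
  normsq (fun i => g x i - g y i) <= L ^+ 2 * normsq (fun i => x i - y i).
Proof.
move=> L0 gL x y; have := gL x y.
move=> /(ler_pM (sqrtr_ge0 _) (sqrtr_ge0 _))/(_ (gL x y)).
by rewrite -!expr2 exprMn !sqr_sqrtr ?normsq_ge0.
Qed.

Lemma is_derive_line f g x v (s : R) : is_gradient f g ->
  is_derive s 1 (fun r => f (fun i => x i + r * v i))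
    (\sum_i g (fun i => x i + s * v i) i * v i).
Proof.
move=> fg; have := fg (fun i => x i + s * v i) v.
have -> : (fun t => (f (fun i => x i + s * v i + t * v i)
    - f (fun i => x i + s * v i)) / t) = (fun h : R => h^-1 *:
    (f (fun i => x i + (h *: (1 : R) + s) * v i) - f (fun i => x i + s * v i))).
  apply/funext => t; rewrite mulrC; congr (_ *: (f _ - _)).
  by apply/funext => i; rewrite /GRing.scale/= mulr1; ring.
move=> cv; apply: DeriveDef; first by apply/cvg_ex; eexists; exact: cv.
exact/cvg_lim.
Qed.

Lemma descent f g (L : R) x v : 0 < L -> is_gradient f g -> Assumption2 g L ->
  f (fun i => x i + v i) <= f x + \sum_i g x i * v i + L / 2 * normsq v.
Proof.
move=> L0 fg gL; set c := \sum_i _; set N := normsq v.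
(* The claim is psi 1 <= psi 0, which the mean value theorem reduces to the sign of the derivative
   at one point. *)
pose psi (r : R) := f (fun i => x i + r * v i) - (r * c + L / 2 * N * r ^+ 2).
pose dpsi (r : R) := \sum_i g (fun i => x i + r * v i) i * v i - (c + L * N * r).
have dpsiE r : is_derive r (1 : R) psi (dpsi r).
  have := is_derive_line x v r fg => fd.
  rewrite /psi; apply: is_deriveB; apply: is_derive_eq.
  by rewrite /GRing.scale/= !(mulr0, mulr1, mul0r, addr0, add0r, expr1); field.
have psic : {within `[(0 : R), 1], continuous psi}.
  by apply: derivable_within_continuous => r _; case: (dpsiE r).
have [r] := MVT ltr01 (fun r _ => dpsiE r) psic.
rewrite in_itv/= => /andP[r0 r1]; rewrite /psi.
have -> : (fun i => x i + 1 * v i) = (fun i => x i + v i).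
  by apply/funext => i; rewrite mul1r.
have -> : (fun i => x i + 0 * v i) = x.
  by apply/funext => i; rewrite mul0r addr0.
move=> E.
suff : dpsi r <= 0 by lra.
(* Coordinatewise Young with weight L r in place of Cauchy-Schwarz: after the Lipschitz bound both
   halves are L r N / 2. *)
have H : \sum_i (g (fun i => x i + r * v i) i - g x i) * v i <= L * N * r.
  have Lr : 0 < L * r by rewrite mulr_gt0.
  have /= lip := lipschitz_normsq (ltW L0) gL (fun i => x i + r * v i) x.
  apply: (@le_trans _ _ (\sum_i ((2 * (L * r))^-1 *
     (g (fun i => x i + r * v i) i - g x i) ^+ 2 + L * r / 2 * v i ^+ 2))).
    apply: ler_sum => i _; set a := _ - _; rewrite -subr_ge0.
    rewrite (_ : _ - _ = (2 * (L * r))^-1 * (a - L * r * v i) ^+ 2).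
      by rewrite mulr_ge0 ?sqr_ge0// invr_ge0 mulr_ge0// ltW.
    by field; rewrite !gt_eqF.
  rewrite big_split/= -!mulr_sumr -/(normsq v) -/N.
  move: lip; rewrite (_ : normsq (fun i => x i + r * v i - x i) = r ^+ 2 * N); last first.
    by rewrite /N /normsq mulr_sumr; apply: eq_bigr => i _; ring.
  move=> lip.
  apply: (@le_trans _ _ ((2 * (L * r))^-1 * (L ^+ 2 * (r ^+ 2 * N)) + L * r / 2 * N)).
    by rewrite lerD2r ler_wpM2l// invr_ge0 mulr_ge0// ltW.
  by rewrite le_eqVlt; apply/orP; left; apply/eqP; field; rewrite !gt_eqF.
rewrite /dpsi; move: H; under eq_bigr do rewrite mulrBl.
rewrite sumrB -/c; lra.
Qed.
End Descent.

(** * Stochastic gradients *)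

Lemma measurable_sum_cond (R : realType) d (T : measurableType d) (I : Type)
    (s : seq I) (p : pred I) (h : I -> T -> R) :
  (forall i, measurable_fun setT (h i)) ->
  measurable_fun setT (fun w => \sum_(i <- s | p i) h i w).
Proof.
move=> mh; under eq_fun do rewrite big_mkcond.
by apply: measurable_sum => i; case: (p i).
Qed.

Section RealIntegrals.
Context (R : realType) (d : measure_display) (T : measurableType d)
  (P : probability T R).
Implicit Types h : T -> R.
Notation ig h := (P.-integrable setT (EFin \o h)).

Lemma integrable_EFinZl (c : R) h : ig h -> ig (fun w => c * h w).
Proof. exact: integrableZl. Qed.

Lemma integrable_EFinD h1 h2 : ig h1 -> ig h2 -> ig (fun w => h1 w + h2 w).
Proof.
by move=> i1 i2; rewrite [EFin \o _](_ : _ = (EFin \o h1) \+ (EFin \o h2))%E//;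
  exact: integrableD.
Qed.

Lemma integrable_EFin_cst (c : R) : ig (fun=> c).
Proof. exact: finite_measure_integrable_cst. Qed.

Lemma integrable_EFin_sum (I : Type) (s : seq I) (p : pred I) (h : I -> T -> R) :
  (forall i, p i -> ig (h i)) -> ig (fun w => \sum_(i <- s | p i) h i w).
Proof.
move=> ih; rewrite (_ : EFin \o _ =
    fun w => (\sum_(i <- s | p i) (h i w)%:E)%E).
  exact: integrable_sum.
by apply/funext => w; rewrite /= sumEFin.
Qed.

Lemma integrable_EFin_le h g : measurable_fun setT h ->
  (forall w, 0 <= h w <= g w) -> ig g -> ig h.
Proof.
move=> mh hg; apply: le_integrable => //; first exact/measurable_EFinP.
move=> w _ /=; have /andP[h0 hgw] := hg w.
by rewrite lee_fin !ger0_norm// (le_trans h0 hgw).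
Qed.

Lemma EFin_Rintegral h : ig h -> (\int[P]_w (h w)%:E)%E = (\int[P]_w h w)%:E.
Proof. by move=> ih; rewrite /Rintegral fineK//; exact: integrable_fin_num. Qed.

Lemma Rintegral_sum (I : Type) (s : seq I) (p : pred I) (h : I -> T -> R) :
  (forall i, p i -> ig (h i)) ->
  \int[P]_w (\sum_(i <- s | p i) h i w) = \sum_(i <- s | p i) \int[P]_w h i w.
Proof.
move=> ih; elim: s => [|i s IH].
  rewrite big_nil (_ : (fun w => _) = cst 0); last first.
    by apply/funext => w; rewrite big_nil.
  by rewrite Rintegral_cst// mul0r.
rewrite big_cons -IH; case: ifPn => pi; last first.
  by apply: eq_Rintegral => w _; rewrite big_cons (negbTE pi).
rewrite -RintegralD//; [|exact: ih|exact: integrable_EFin_sum].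
by apply: eq_Rintegral => w _; rewrite big_cons pi.
Qed.

Lemma Rintegral_prob_cst (c : R) : \int[P]_w c = c.
Proof. by rewrite Rintegral_cst// [X in fine X](probability_setT P) mulr1. Qed.

Lemma integrable_EFin_lty h : measurable_fun setT h -> (forall w, 0 <= h w) ->
  (\int[P]_w (h w)%:E < +oo)%E -> ig h.
Proof.
move=> mh h0 hoo; apply/integrableP; split; first exact/measurable_EFinP.
by under eq_integral do rewrite /= ger0_norm//.
Qed.
End RealIntegrals.

(** * Variance of the gradient noise and measurability of the run *)

Section Noise.
Context (R : realType) (dX : measure_display) (Xi : measurableType dX)
  (D : probability Xi R) (NL : nat) (m n : 'I_NL -> nat)
  (G : (pcoord m n -> R) -> Xi -> pcoord m n -> R)
  (gradf : (pcoord m n -> R) -> pcoord m n -> R) (sig : 'I_NL -> R).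
Hypothesis A3 : Assumption3 D G gradf sig.

Lemma normsq_layers (v : pcoord m n -> R) : normsq v = \sum_l layer_normsq l v.
Proof.
rewrite /normsq /layer_normsq (exchange_big_dep xpredT)//=.
apply: eq_bigr => i _.
by rewrite (eq_bigl (fun l => l == tag i)) ?big_pred1_eq// => l; rewrite eq_sym.
Qed.

Let nz x i z := G x z i - gradf x i.

Let nz_int x i : D.-integrable setT (EFin \o nz x i).
Proof.
case: A3 => /(_ x i)[ig _] _; apply: (integrable_EFinD ig).
exact: integrable_EFin_cst.
Qed.

Let nz_mean x i : \int[D]_z nz x i z = 0.
Proof.
case: A3 => /(_ x i)[ig Ei] _; rewrite RintegralB//; last exact: integrable_EFin_cst.
by rewrite Rintegral_prob_cst {1}/Rintegral Ei subrr.
Qed.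

Let mnz x i : measurable_fun setT (nz x i).
Proof. by have /measurable_int/measurable_EFinP := nz_int x i. Qed.

Let layer_int x l : D.-integrable setT (EFin \o (fun z => layer_normsq l (nz x ^~ z))).
Proof.
apply: integrable_EFin_lty.
- by apply: measurable_sum_cond => i; apply: measurable_funX; exact: mnz.
- by move=> z; apply: sumr_ge0 => i _; exact: sqr_ge0.
- case: A3 => _ [_ /(_ x l)] /le_lt_trans; apply; exact: ltry.
Qed.

Let nz2_int x i : D.-integrable setT (EFin \o (fun z => nz x i z ^+ 2)).
Proof.
apply: integrable_EFin_le (layer_int x (tag i)).
  by apply: measurable_funX; exact: mnz.
move=> z; rewrite sqr_ge0/= /layer_normsq (bigD1 i)//= lerDl.
by apply: sumr_ge0 => j _; exact: sqr_ge0.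
Qed.

Lemma noise_variance_le x : \int[D]_z normsq (nz x ^~ z) <= sigma2 sig.
Proof.
under eq_Rintegral do rewrite normsq_layers.
rewrite Rintegral_sum => [|l _]; last exact: layer_int.
apply: ler_sum => l _; rewrite -lee_fin -EFin_Rintegral; last exact: layer_int.
by case: A3 => _ [_ /(_ x l)].
Qed.

(** The cross term is linear in the centred noise and integrates to 0. The weights [c] vary with the
    coordinate because they will carry the mask. *)
Lemma noise_second_moment x (phi c : pcoord m n -> R) (kappa : R) :
  (forall i, c i ^+ 2 <= kappa) -> 0 <= kappa ->
  (\int[D]_z (normsq (fun i => (phi i + c i * (G x z i - gradf x i))%R))%:E
    <= (normsq phi + kappa * sigma2 sig)%:E)%E.
Proof.
move=> ck k0.
have E z : normsq (fun i => phi i + c i * (G x z i - gradf x i)) =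
    normsq phi + (\sum_i 2 * phi i * c i * nz x i z + \sum_i c i ^+ 2 * nz x i z ^+ 2).
  rewrite /normsq -!big_split/=; apply: eq_bigr => i _.
  by rewrite -/(nz x i z); ring.
under eq_integral do rewrite E.
have i1 : D.-integrable setT (EFin \o (fun z => \sum_i 2 * phi i * c i * nz x i z)).
  by apply: integrable_EFin_sum => i _; apply: integrable_EFinZl; exact: nz_int.
have i2 : D.-integrable setT (EFin \o (fun z => \sum_i c i ^+ 2 * nz x i z ^+ 2)).
  by apply: integrable_EFin_sum => i _; apply: integrable_EFinZl; exact: nz2_int.
rewrite EFin_Rintegral; last first.
  by apply: integrable_EFinD; [exact: integrable_EFin_cst|exact: integrable_EFinD].
rewrite lee_fin RintegralD//; [|exact: integrable_EFin_cst|exact: integrable_EFinD].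
rewrite RintegralD// Rintegral_prob_cst lerD2l.
rewrite Rintegral_sum => [|i _]; last by apply: integrable_EFinZl; exact: nz_int.
rewrite big1 => [|i _]; last by rewrite RintegralZl// nz_mean mulr0.
rewrite add0r (le_trans _ (ler_wpM2l k0 (noise_variance_le x)))//.
rewrite -RintegralZl//; last by apply: integrable_EFin_sum => i _; exact: nz2_int.
apply: le_Rintegral => //.
  by apply: integrable_EFinZl; apply: integrable_EFin_sum => i _; exact: nz2_int.
move=> z _; rewrite mulr_sumr; apply: ler_sum => i _.
by rewrite ler_wpM2r// sqr_ge0.
Qed.

Hypothesis mG : jointly_measurable G.

(* Measurability comes for free from gradf x = E G(x; xi), by Fubini. *)
Lemma measurable_gradf d (T : measurableType d) (X : pcoord m n -> T -> R) j :
  (forall i, measurable_fun setT (X i)) ->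
  measurable_fun setT (fun w => gradf (fun i => X i w) j).
Proof.
move=> mX.
pose h (p : T * Xi) := (G (fun i => X i p.1) p.2 j)%:E.
have mh : measurable_fun setT h.
  apply/measurable_EFinP.
  apply: (mG (X := fun i (p : T * Xi) => X i p.1) (Y := snd)) => [i|].
    by apply: measurableT_comp => //; exact: measurable_fst.
  exact: measurable_snd.
apply/measurable_EFinP.
(* Tonelli needs nonnegative integrands, so the two signs are integrated separately. *)
rewrite (_ : EFin \o _ = (fun w => fubini_F D (h^\+)%E w - fubini_F D (h^\-)%E w)%E); last first.
  apply/funext => w; rewrite /= ; case: A3 => /(_ (fun i => X i w) j)[_ <-] _.
  rewrite integralE; congr (_ - _)%E; apply: eq_integral => z _.
    by rewrite !funeposE.
  by rewrite !funenegE.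
apply: emeasurable_funB.
  by apply: measurable_fun_fubini_tonelli_F => //; exact: measurable_funepos.
by apply: measurable_fun_fubini_tonelli_F => //; exact: measurable_funeneg.
Qed.

Lemma measurable_bool_natr d (T : measurableType d) (V : T -> {ffun pcoord m n -> bool}) i :
  (forall s, measurable (V @^-1` [set s])) ->
  measurable_fun setT (fun w => (V w i : nat)%:R : R).
Proof.
move=> mV; rewrite (_ : (fun w => _) = \1_(V @^-1` [set s : {ffun pcoord m n -> bool} | s i])).
  by apply: measurable_indic; exact: measurable_finType_preimage.
apply/funext => w; rewrite indicE; congr (_%:R); congr nat_of_bool.
by apply/idP/idP => [?|/set_mem//]; exact/mem_set.
Qed.

(** The sigma-algebra is arbitrary and only samples used before step [t] have to be measurable, so
    that this serves the full space as well as [xi_past] and [U_past]. *)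
Lemma measurable_gosare_state d (T : measurableType d) (xi : nat -> T -> Xi)
    (U : nat -> T -> {ffun pcoord m n -> bool}) x0 beta eta tau t :
  (forall s, (s < t)%N -> measurable_fun setT (xi s)) ->
  (forall s r, (s < t)%N -> measurable (U (s %/ tau)%N @^-1` [set r])) ->
  forall i,
    measurable_fun setT (fun w => (gosare_state G xi U x0 beta eta tau w t).1 i) /\
    measurable_fun setT (fun w => (gosare_state G xi U x0 beta eta tau w t).2 i).
Proof.
elim: t => [|t IH] mxi mU i /=; first by split; exact: measurable_cst.
have {}IH := IH (fun s st => mxi s (ltnW st)) (fun s r st => mU s r (ltnW st)).
have mS j : measurable_fun setT (fun w => (U (t %/ tau)%N w j : nat)%:R : R).
  by apply: measurable_bool_natr => r; exact: mU.
have mGx : measurable_fun setT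
    (fun w => G (gosare_state G xi U x0 beta eta tau w t).1 (xi t w) i).
  apply: mG; last exact: mxi.
  by move=> j; exact: (IH j).1.
have mM : measurable_fun setT (fun w => (1 - beta) * (U (t %/ tau)%N w i : nat)%:R *
    (gosare_state G xi U x0 beta eta tau w t).2 i + beta * (U (t %/ tau)%N w i : nat)%:R *
    G (gosare_state G xi U x0 beta eta tau w t).1 (xi t w) i).
  apply: measurable_funD; apply: measurable_funM => //.
  - by apply: measurable_funM.
  - exact: (IH i).2.
  - by apply: measurable_funM.
split => //; apply: measurable_funB; first exact: (IH i).1.
by apply: measurable_funM => //; apply: measurable_funM.
Qed.
End Noise.

(** * Averaging over one gradient sample or one mask *)

Section GoSare.
Context (R : realType) (NL : nat) (m n k : 'I_NL -> nat)
  (dX : measure_display) (Xi : measurableType dX) (D : probability Xi R)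
  (gradf : (pcoord m n -> R) -> pcoord m n -> R)
  (G : (pcoord m n -> R) -> Xi -> pcoord m n -> R) (sig : 'I_NL -> R)
  (dO : measure_display) (Om : measurableType dO) (P : probability Om R)
  (xi : nat -> Om -> Xi) (U : nat -> Om -> {ffun pcoord m n -> bool})
  (x0 : pcoord m n -> R) (beta eta : R) (tau : nat).
Hypothesis A3 : Assumption3 D G gradf sig.
Hypothesis mG : jointly_measurable G.
Hypothesis HS : sampling_model D k P xi U.

Notation iter_x t w := (gosare_state G xi U x0 beta eta tau w t).1.
(* [state t] carries M^(t-1), so the momentum M^(t) is [iter_M t.+1]. *)
Notation iter_M t w := (gosare_state G xi U x0 beta eta tau w t).2.
Notation mask t w i := ((U (t %/ tau)%N w i : nat)%:R : R).

Let xi_meas t s : (s < t)%N ->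
  measurable_fun (setT : set (xi_past xi U t.+1 t)) (xi s).
Proof.
move=> st; apply: measurable_xi_cyls; first exact: ltnW.
by rewrite /= ltn_eqF.
Qed.

Let U_meas t s r : (s <= t)%N ->
  measurable (U (s %/ tau)%N @^-1` [set r] : set (xi_past xi U t.+1 t)).
Proof.
move=> st; apply: measurable_U_cyls => //.
by rewrite ltnS (leq_trans (leq_div _ _)).
Qed.

Let past_state t i :
  measurable_fun (setT : set (xi_past xi U t.+1 t)) (fun w => iter_x t w i) /\
  measurable_fun (setT : set (xi_past xi U t.+1 t)) (fun w => iter_M t w i).
Proof.
apply: (measurable_gosare_state mG) => s; first exact: xi_meas.
by move=> r st; apply: U_meas; exact: ltnW.
Qed.

Let past_mask t i :
  measurable_fun (setT : set (xi_past xi U t.+1 t)) (fun w => mask t w i).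
Proof. by apply: measurable_bool_natr => s; exact: U_meas. Qed.

Lemma measurable_iter t i : measurable_fun setT (fun w => iter_x t w i) /\
  measurable_fun setT (fun w => iter_M t w i).
Proof.
apply: (measurable_gosare_state mG) => s; first by case: HS.
by move=> r _; case: HS => _ [].
Qed.

Lemma measurable_grad t i : measurable_fun setT (fun w => gradf (iter_x t w) i).
Proof.
by apply: (measurable_gradf A3 mG (X := fun i w => iter_x t w i)) => j;
  case: (measurable_iter t j).
Qed.

Lemma measurable_mask t i : measurable_fun setT (fun w => mask t w i).
Proof. by apply: measurable_bool_natr => s; case: HS => _ []. Qed.

Lemma measurable_normsq d (T : measurableType d) (V : T -> pcoord m n -> R) :
  (forall i, measurable_fun setT (fun w => V w i)) ->
  measurable_fun setT (fun w => normsq (V w)).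
Proof.
by move=> mV; apply: measurable_sum_cond => i; exact: measurable_funX.
Qed.

Lemma mask_sqr t w i : mask t w i ^+ 2 = mask t w i.
Proof. by case: (U _ _ _); rewrite ?expr1n// expr0n. Qed.

(** On the mask the error is (1 - beta) S (M^(t-1) - g) + beta S (G - g), as the weights sum to 1
    and S is idempotent. The first term is determined before xi^(t) is drawn; the second is centred
    given the past. *)
Lemma noise_step t :
  (\int[P]_w (normsq (fun i => mask t w i *
       (iter_M t.+1 w i - gradf (iter_x t w) i))%R)%:E
   <= \int[P]_w (normsq (fun i => (1 - beta) * mask t w i *
       (iter_M t w i - gradf (iter_x t w) i))%R)%:E
      + (beta ^+ 2 * sigma2 sig)%:E)%E.
Proof.
pose phi w i := (1 - beta) * mask t w i * (iter_M t w i - gradf (iter_x t w) i).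
pose H (p : xi_past xi U t.+1 t * Xi) := (normsq (fun i =>
  phi p.1 i + beta * mask t p.1 i * (G (iter_x t p.1) p.2 i - gradf (iter_x t p.1) i)))%:E.
have past_grad i : measurable_fun (setT : set (xi_past xi U t.+1 t))
    (fun w => gradf (iter_x t w) i).
  apply: (measurable_gradf A3 mG (T := xi_past xi U t.+1 t)
    (X := fun i w => iter_x t w i)) => j.
  by case: (past_state t j).
have mphi i : measurable_fun (setT : set (xi_past xi U t.+1 t)) (fun w => phi w i).
  apply: measurable_funM.
    by apply: measurable_funM => //; exact: past_mask.
  by apply: measurable_funB => //; case: (past_state t i).
have mH : measurable_fun setT H.
  apply/measurable_EFinP; apply: measurable_normsq => i.
  have c1 (h : xi_past xi U t.+1 t -> R) : measurable_fun setT h ->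
      measurable_fun setT (fun p : xi_past xi U t.+1 t * Xi => h p.1).
    by move=> mh; apply: measurableT_comp => //; exact: measurable_fst.
  apply: measurable_funD; first exact: (c1 (fun w => phi w i)).
  apply: measurable_funM.
    apply: (c1 (fun w => beta * mask t w i)).
    by apply: measurable_funM => //; exact: past_mask.
  apply: measurable_funB; last exact: (c1 (fun w => gradf (iter_x t w) i)).
  apply: (mG (X := fun i (p : xi_past xi U t.+1 t * Xi) => iter_x t p.1 i) (Y := snd)).
    by move=> j; exact: (c1 _ (past_state t j).1).
  exact: measurable_snd.
have -> : (\int[P]_w (normsq (fun i => mask t w i *
       (iter_M t.+1 w i - gradf (iter_x t w) i))%R)%:E = \int[P]_w H (w, xi t w))%E.
  apply: eq_integral => w _; rewrite /H /phi; congr (_%:E).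
  apply: eq_bigr => i _; congr (_ ^+ 2) => /=.
  have := mask_sqr t w i; set s := mask t w i => s2.
  transitivity ((1 - beta) * (s ^+ 2) * iter_M t w i +
    beta * (s ^+ 2) * G (iter_x t w) (xi t w) i - s * gradf (iter_x t w) i); first by ring.
  by rewrite s2; ring.
rewrite (@indep_tonelli _ _ _ _ _ (xi_past xi U t.+1 t) _ P D id (xi t)
    (cyls xi U t.+1 (predC1 t) predT)) //; first last.
- by move=> x; rewrite lee_fin normsq_ge0.
- by move=> A B cA mB; exact: (cyls_xi_indep HS (ltnSn t) cA mB).
- exact: cyls_setT.
- exact: cyls_setI.
- by case: HS.
- exact: (measurable_id_cyls HS).
have mphi2 : measurable_fun setT (fun w : Om => normsq (phi w)).
  apply: measurable_normsq => i; apply: measurable_funM.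
    by apply: measurable_funM => //; exact: measurable_mask.
  by apply: measurable_funB; [case: (measurable_iter t i)|exact: measurable_grad].
have s0 : 0 <= sigma2 sig by apply: sumr_ge0 => l _; exact: sqr_ge0.
have -> : (beta ^+ 2 * sigma2 sig)%:E = (\int[P]_w (cst (beta ^+ 2 * sigma2 sig)%:E w))%E.
  by rewrite integral_cst// [X in (_ * X)%E](probability_setT P) mule1.
rewrite -ge0_integralD//; first last.
- by move=> w _; rewrite lee_fin mulr_ge0// sqr_ge0.
- exact/measurable_EFinP.
- by move=> w _; rewrite lee_fin normsq_ge0.
apply: ge0_le_integral => //.
- by move=> w _; apply: integral_ge0 => z _; rewrite lee_fin normsq_ge0.
- have H0 x : (0 <= H x)%E by rewrite lee_fin normsq_ge0.
  have mF := measurable_fun_fubini_tonelli_F (m2 := D) H mH H0.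
  have mI := @measurable_id_cyls _ _ _ _ _ _ _ _ _ _ _ _ _ HS t.+1 (predC1 t) predT.
  exact: (measurableT_comp mF mI).
- by apply/measurable_EFinP; apply: measurable_funD.
move=> w _; rewrite /H /= -EFinD.
apply: (noise_second_moment A3) => [i|]; last exact: sqr_ge0.
rewrite exprMn mask_sqr; case: (U _ _ _); rewrite ?mulr1// mulr0; exact: sqr_ge0.
Qed.

(* Inside the block started at t, the mask is [U (t %/ tau)], which x^(t) has not
   seen yet. *)
Let U_past_state t i : (0 < tau)%N -> (tau %| t)%N ->
  measurable_fun (setT : set (U_past xi U t.+1 (t %/ tau)%N)) (fun w => iter_x t w i).
Proof.
move=> tau0 taut.
have [|s r st|//] := @measurable_gosare_state _ _ _ _ _ _ G mG _
  (U_past xi U t.+1 (t %/ tau)%N) xi U x0 beta eta tau t _ _ i => [s|].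
  by move=> st; apply: measurable_xi_cyls => //; exact: ltnW.
apply: measurable_U_cyls.
  by rewrite ltnS (leq_trans (leq_div _ _))// ltnW.
(* As [tau] divides t, every s < t has s / tau < t / tau: x^(t) has used earlier masks only. *)
by rewrite /= ltn_eqF// ltn_divLR// divnK.
Qed.

Lemma mask_marginal j i : (0 < m (tag i) * n (tag i))%N ->
  P (U j @^-1` [set s : {ffun pcoord m n -> bool} | s i]) =
  (delta m n k (tag i))%:E.
Proof.
move=> mn0; rewrite -(unif_mask_coord mn0 (masks_neq0 HS)) -[RHS]mul1e.
rewrite -(probability_setT P) -(cyls_U_indep HS _ (ltnSn j) (cyls_setT _ _ _ _ _)).
by rewrite setTI; congr (P _); apply/seteqP; split => w; rewrite /= inE.
Qed.

Lemma offmask_coord t i : (0 < tau)%N -> (tau %| t)%N ->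
  (0 < m (tag i) * n (tag i))%N ->
  (\int[P]_w ((1 - mask t w i) * gradf (iter_x t w) i ^+ 2)%:E =
   (1 - delta m n k (tag i))%:E * \int[P]_w (gradf (iter_x t w) i ^+ 2)%:E)%E.
Proof.
move=> tau0 taut mn0; set j := (t %/ tau)%N.
have jt : (j < t.+1)%N by rewrite ltnS leq_div.
(* Only one bit of the mask matters; its law on [bool] comes from [mask_marginal]. *)
pose Y w := U j w i.
have YE (B : set bool) : Y @^-1` B =
    U j @^-1` [set s | s \in [set s : {ffun pcoord m n -> bool} | `[< B (s i) >]]%SET].
  by apply/seteqP; split => w /=; rewrite inE => /asboolP.
have mY : measurable_fun setT Y.
  by move=> _ B _; rewrite setTI YE; exact: (measurable_mask_preimage HS).
pose Y' : {mfun Om >-> bool} := HB.pack Y (isMeasurableFun.Build _ _ _ _ _ mY).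
pose H (p : U_past xi U t.+1 j * bool) :=
  ((1 - (p.2 : nat)%:R) * gradf (iter_x t p.1) i ^+ 2)%:E.
have mg : measurable_fun (setT : set (U_past xi U t.+1 j))
    (fun w => gradf (iter_x t w) i).
  apply: (measurable_gradf A3 mG (T := U_past xi U t.+1 j)
    (X := fun i w => iter_x t w i)) => l.
  exact: U_past_state.
have mb : measurable_fun setT (fun b : bool => 1 - (b : nat)%:R : R) by [].
have mH : measurable_fun setT H.
  apply/measurable_EFinP; apply: measurable_funM.
    exact: (measurableT_comp mb measurable_snd).
  apply: measurable_funX.
  exact: (measurableT_comp mg measurable_fst).
have H0 x : (0 <= H x)%E.
  rewrite lee_fin mulr_ge0 ?sqr_ge0//.
  by case: (x.2); rewrite ?subrr// subr0.
rewrite (@indep_tonelli _ _ _ _ _ (U_past xi U t.+1 j) _ P (distribution P Y') id Y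
    (cyls xi U t.+1 predT (predC1 j)) _ _ _ _ _ _ H) //; first last.
- move=> A B cA _; change (P (A `&` Y @^-1` B) = P A * P (Y @^-1` B))%E.
  rewrite YE (cyls_U_indep HS _ jt cA); congr (_ * _)%E.
  by rewrite -(setTI (_ @^-1` _)) (cyls_U_indep HS _ jt (cyls_setT _ _ _ _ _))
    probability_setT mul1e.
- exact: cyls_setT.
- exact: cyls_setI.
- exact: (measurable_id_cyls HS).
have mgO := measurable_grad t i.
rewrite -ge0_integralZl//; first last.
- rewrite lee_fin subr_ge0 -lee_fin -(mask_marginal j mn0).
  by apply: probability_le1; apply: measurable_finType_preimage => s; case: HS => _ [].
- by move=> w _; rewrite lee_fin sqr_ge0.
- by apply/measurable_EFinP; exact: measurable_funX.
apply: eq_integral => w _; rewrite /H /=.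
set c := gradf _ _ ^+ 2; have c0 : 0 <= c by exact: sqr_ge0.
rewrite ge0_integral_distribution//; first last.
- by move=> b; rewrite lee_fin mulr_ge0//; case: b; rewrite ?subrr ?subr0.
transitivity (\int[P]_x (c%:E * (\1_(~` (Y @^-1` [set true])) x)%:E))%E.
  apply: eq_integral => x _; rewrite /= -EFinM mulrC; congr (c * _)%:E.
  rewrite indicE /Y; case E : (U j x i).
    by rewrite subrr memNset// => /= /(_ E).
  by rewrite subr0 mem_set//= E.
have mYt : measurable (~` (Y @^-1` [set true])).
  by apply: measurableC; rewrite YE; exact: (measurable_mask_preimage HS).
rewrite ge0_integralZl//; last exact/measurable_EFinP.
rewrite integral_indic// setIT.
have PC : (P (~` (Y @^-1` [set true])) = (1 - delta m n k (tag i))%:E)%E.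
  rewrite probability_setC; first by rewrite [P _](mask_marginal j mn0) -EFinB.
  by rewrite YE; exact: (measurable_mask_preimage HS).
by rewrite [X in (_ * X)%E]PC muleC.
Qed.

End GoSare.

(** * Inequalities along one run *)

(** Cauchy-Schwarz for r increments. In the induction the cross term is split by Young with weight
    r, so that the induction hypothesis absorbs A^2 / r. *)
Lemma sqr_telescope_le (R : realFieldType) (y : nat -> R) (r : nat) :
  (y r - y 0) ^+ 2 <= r%:R * \sum_(u < r) (y u.+1 - y u) ^+ 2.
Proof.
elim: r => [|r IH]; first by rewrite subrr expr0n mul0r.
rewrite big_ord_recr/=; set S := \sum_(_ < _) _ in IH *.
have [->|r0] := eqVneq r 0%N.
  have : 0 <= S by apply: sumr_ge0 => i _; exact: sqr_ge0.
  by rewrite mul1r lerDr.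
have {}r0 : 0 < r%:R :> R by rewrite ltr0n lt0n.
set A := y r - y 0 in IH *; set b := y r.+1 - y r.
have -> : y r.+1 - y 0 = A + b by rewrite /A /b; ring.
have H : 2 * A * b <= S + r%:R * b ^+ 2.
  have : 2 * A * b <= r%:R^-1 * A ^+ 2 + r%:R * b ^+ 2.
    rewrite -subr_ge0 (_ : _ - _ = r%:R^-1 * (A - r%:R * b) ^+ 2).
      by rewrite mulr_ge0 ?sqr_ge0// invr_ge0 ltW.
    by field; rewrite gt_eqF.
  move=> /le_trans; apply; rewrite lerD2r.
  by rewrite mulrC ler_pdivrMr// mulrC.
rewrite -natr1; lra.
Qed.

Lemma sqrD_le_weighted (R : realFieldType) (c a b : R) : 0 < c ->
  (a + b) ^+ 2 <= (1 + c) * a ^+ 2 + (1 + c^-1) * b ^+ 2.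
Proof.
move=> c0; rewrite -subr_ge0 (_ : _ - _ = c^-1 * (c * a - b) ^+ 2).
  by rewrite mulr_ge0 ?sqr_ge0// invr_ge0 ltW.
by field; rewrite gt_eqF.
Qed.

Section NormsqInequalities.
Context (R : realType) (I : finType).
Implicit Types u v : I -> R.

Lemma normsq_le u v : (forall i, u i ^+ 2 <= v i ^+ 2) -> normsq u <= normsq v.
Proof. by move=> uv; apply: ler_sum. Qed.

Lemma normsq_le2 (a b : R) u v z :
  (forall i, z i ^+ 2 <= a * u i ^+ 2 + b * v i ^+ 2) ->
  normsq z <= a * normsq u + b * normsq v.
Proof.
move=> uv; rewrite /normsq !mulr_sumr -big_split/=; exact: ler_sum.
Qed.
End NormsqInequalities.

Section Paths.
Context (R : realType) (I : finType) (Xi Om : Type)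
  (f : (I -> R) -> R) (gradf : (I -> R) -> I -> R)
  (G : (I -> R) -> Xi -> I -> R) (L : R)
  (xi : nat -> Om -> Xi) (U : nat -> Om -> {ffun I -> bool})
  (x0 : I -> R) (beta eta : R) (tau : nat).
Hypothesis gf : is_gradient f gradf.
Hypothesis A1 : Assumption1 f.
Hypothesis A2 : Assumption2 gradf L.
Hypothesis L0 : 0 < L.
Hypothesis beta01 : 0 < beta <= 1.
Hypothesis eta0 : 0 < eta.
Hypothesis tau0 : (0 < tau)%N.

Notation iter_x t w := (gosare_state G xi U x0 beta eta tau w t).1.
Notation iter_M t w := (gosare_state G xi U x0 beta eta tau w t).2.
Notation mask t w i := ((U (t %/ tau)%N w i : nat)%:R : R).

Definition grad_sq t w := normsq (gradf (iter_x t w)).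
Definition onmask_err t w :=
  normsq (fun i => mask t w i * (iter_M t.+1 w i - gradf (iter_x t w) i)).
Definition offmask_sq t w :=
  normsq (fun i => (1 - mask t w i) * gradf (iter_x t w) i).
Definition step_sq t w := normsq (fun i => iter_x t.+1 w i - iter_x t w i).

Lemma iter_M_masked t w i : mask t w i * iter_M t.+1 w i = iter_M t.+1 w i.
Proof.
by rewrite /=; case: (U _ _ _); rewrite ?mul1r// !(mulr0, mul0r, addr0).
Qed.

Lemma iter_xS t w i : iter_x t.+1 w i = iter_x t w i - eta * iter_M t.+1 w i.
Proof. by rewrite -[in RHS]iter_M_masked mulrA. Qed.

Lemma momentum_error t w :
  normsq (fun i => iter_M t.+1 w i - gradf (iter_x t w) i) =
  onmask_err t w + offmask_sq t w.
Proof.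
rewrite /onmask_err /offmask_sq /normsq -big_split/=; apply: eq_bigr => i _.
have := iter_M_masked t w i => /=; case: (U _ _ _) => /= M.
  by rewrite subrr !mul1r mul0r expr0n addr0.
by rewrite -M !mul0r expr0n sub0r subr0 mul1r add0r sqrrN.
Qed.

Lemma step_sqE t w : step_sq t w = eta ^+ 2 * normsq (iter_M t.+1 w).
Proof.
rewrite /step_sq /normsq mulr_sumr; apply: eq_bigr => i _.
rewrite iter_xS; ring.
Qed.

(** Polarization turns -<g, M> into half of |M - g|^2 - |g|^2 - |M|^2. The last term, rewritten as a
    squared step, is the budget that later pays for all drift. *)
Lemma descent_step t w :
  eta / 2 * grad_sq t w + ((2 * eta)^-1 - L / 2) * step_sq t w <=
  f (iter_x t w) - f (iter_x t.+1 w) + eta / 2 * (onmask_err t w + offmask_sq t w).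
Proof.
have := descent (iter_x t w) (fun i => - (eta * iter_M t.+1 w i)) L0 gf A2.
rewrite (_ : (fun i => iter_x t w i + - (eta * iter_M t.+1 w i)) = iter_x t.+1 w); last first.
  by apply/funext => i; rewrite [RHS]iter_xS.
rewrite (_ : normsq (fun i => - (eta * _)) = step_sq t w); last first.
  by apply: eq_bigr => i _; rewrite iter_xS; congr (_ ^+ 2); ring.
rewrite -momentum_error step_sqE.
have -> : \sum_i gradf (iter_x t w) i * - (eta * iter_M t.+1 w i) =
    eta / 2 * (normsq (fun i => iter_M t.+1 w i - gradf (iter_x t w) i)
      - grad_sq t w - normsq (iter_M t.+1 w)).
  rewrite /grad_sq /normsq -!sumrB mulr_sumr; apply: eq_bigr => i _.
  by field.
have -> : ((2 * eta)^-1 - L / 2) * (eta ^+ 2 * normsq (iter_M t.+1 w)) =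
    eta / 2 * normsq (iter_M t.+1 w) - L / 2 * (eta ^+ 2 * normsq (iter_M t.+1 w)).
  by field; rewrite gt_eqF.
lra.
Qed.

Lemma descent_sum T w :
  \sum_(t < T) (eta / 2 * grad_sq t w + ((2 * eta)^-1 - L / 2) * step_sq t w) <=
  Delta f x0 + \sum_(t < T) (eta / 2 * (onmask_err t w + offmask_sq t w)).
Proof.
have H : \sum_(t < T) (eta / 2 * grad_sq t w + ((2 * eta)^-1 - L / 2) * step_sq t w) <=
    f x0 - f (iter_x T w) + \sum_(t < T) (eta / 2 * (onmask_err t w + offmask_sq t w)).
  elim: T => [|T IH]; first by rewrite !big_ord0 addr0/= subrr.
  rewrite !big_ord_recr/=; have := descent_step T w => /=; lra.
rewrite (le_trans H)// lerD2r lerD2l lerN2.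
by apply: ge_inf => //; exists (iter_x T w).
Qed.

Lemma grad_lipschitz_step t w :
  normsq (fun i => gradf (iter_x t w) i - gradf (iter_x t.+1 w) i) <= L ^+ 2 * step_sq t w.
Proof.
rewrite (le_trans (lipschitz_normsq (ltW L0) A2 _ _))// ler_wpM2l ?sqr_ge0//.
by apply: normsq_le => i; rewrite -sqrrN opprB.
Qed.

(** Coordinates kept by the old mask contract. A coordinate it dropped has zero momentum, so its
    error is at most the squared gradient entry, and it counts only when a new mask is drawn, since
    otherwise it is still dropped. *)
Lemma onmask_pred_le t w :
  normsq (fun i => (1 - beta) * mask t.+1 w i *
     (iter_M t.+1 w i - gradf (iter_x t.+1 w) i)) <=
  (1 - beta) * onmask_err t w + L ^+ 2 / beta * step_sq t w
  + (tau %| t.+1)%:R * grad_sq t.+1 w.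
Proof.
move: beta01 => /andP[b0 b1].
set g := gradf (iter_x t.+1 w); set g' := gradf (iter_x t w).
apply: (@le_trans _ _ (\sum_i ((1 - beta) * (mask t w i * (iter_M t.+1 w i - g' i)) ^+ 2
   + beta^-1 * (g' i - g i) ^+ 2 + (tau %| t.+1)%:R * g i ^+ 2))); last first.
  rewrite !big_split/= -!mulr_sumr lerD2r lerD2l.
  have -> : L ^+ 2 / beta * step_sq t w = beta^-1 * (L ^+ 2 * step_sq t w) by ring.
  by rewrite ler_wpM2l ?invr_ge0 ?(ltW b0)// grad_lipschitz_step.
apply: ler_sum => i _; have := iter_M_masked t w i.
set M := iter_M t.+1 w i => MM.
have dg0 : 0 <= (tau %| t.+1)%:R * g i ^+ 2 by rewrite mulr_ge0 ?sqr_ge0.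
have bg0 : 0 <= beta^-1 * (g' i - g i) ^+ 2.
  by rewrite mulr_ge0 ?sqr_ge0// invr_ge0 ltW.
(* Young with weight beta: (1 - beta)^2 (1 + beta) <= 1 - beta and (1 - beta)^2 (1 + 1/beta) <=
   1/beta. *)
have H : ((1 - beta) * (M - g i)) ^+ 2 <=
    (1 - beta) * (M - g' i) ^+ 2 + beta^-1 * (g' i - g i) ^+ 2.
  have -> : M - g i = (M - g' i) + (g' i - g i) by ring.
  rewrite exprMn (le_trans (ler_wpM2l (sqr_ge0 _) (sqrD_le_weighted _ _ b0)))//.
  have A0 := sqr_ge0 (M - g' i); have B0 := sqr_ge0 (g' i - g i).
  move: ((M - g' i) ^+ 2) ((g' i - g i) ^+ 2) A0 B0 => A B A0 B0.
  rewrite mulrDr [X in X + _]mulrA [X in _ + X]mulrA.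
  apply: lerD; apply: ler_wpM2r => //.
    have : 0 <= (1 - beta) * beta ^+ 2 by rewrite mulr_ge0 ?sqr_ge0// subr_ge0.
    lra.
  rewrite -(@ler_pM2r _ beta)// mulVf ?gt_eqF//.
  rewrite (_ : _ * beta = (1 - beta) ^+ 2 * (1 + beta)); last by field; rewrite gt_eqF.
  have : 0 <= (1 - beta) * beta ^+ 2 by rewrite mulr_ge0 ?sqr_ge0// subr_ge0.
  lra.
move: MM; case E : (U (t %/ tau)%N w i) => MM; rewrite /= in MM.
  rewrite !mul1r; apply: le_trans (le_trans H _); last by rewrite lerDl.
  case: (U _ _ _); rewrite /= ?mulr1// mulr0 mul0r expr0n; exact: sqr_ge0.
rewrite -{}MM !mul0r expr0n mulr0 add0r divnS//.
case: (boolP (tau %| t.+1)%N) => _; last first.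
  by rewrite add0n E/= mulr0 !mul0r expr0n/= addr0 add0r.
rewrite mul1r add0r; apply: ler_wpDl => //; rewrite mulrN sqrrN exprMn.
rewrite ler_piMl ?sqr_ge0//.
case: (U _ _ _); rewrite /= ?mulr1 ?mulr0 ?expr0n//; nra.
Qed.

Lemma onmask_init_le w :
  normsq (fun i => (1 - beta) * mask 0 w i * (iter_M 0 w i - gradf (iter_x 0 w) i))
  <= grad_sq 0 w.
Proof.
move: beta01 => /andP[b0 b1].
apply: normsq_le => i; rewrite sub0r mulrN sqrrN exprMn ler_piMl ?sqr_ge0//.
case: (U _ _ _); rewrite /= ?mulr1 ?mulr0 ?expr0n//; nra.
Qed.

Lemma grad_drift q r w :
  normsq (fun i => gradf (iter_x (q + r)%N w) i - gradf (iter_x q w) i) <=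
  L ^+ 2 * (r%:R * \sum_(u < r) step_sq (q + u)%N w).
Proof.
rewrite (le_trans (lipschitz_normsq (ltW L0) A2 _ _))// ler_wpM2l ?sqr_ge0//.
rewrite /normsq /step_sq exchange_big/= mulr_sumr; apply: ler_sum => i _.
have := sqr_telescope_le (fun u => iter_x (q + u)%N w i) r.
rewrite addn0 => /le_trans; apply; rewrite ler_wpM2l//.
by apply: ler_sum => u _; rewrite addnS.
Qed.

(** Both times belong to block j, hence share one mask, and only the gradient moves. *)
Lemma offmask_drift (c : R) j r w : 0 < c -> (r < tau)%N ->
  offmask_sq (j * tau + r)%N w <= (1 + c) * offmask_sq (j * tau)%N w
   + (1 + c^-1) * (L ^+ 2 * (r%:R * \sum_(u < r) step_sq (j * tau + u)%N w)).
Proof.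
move=> c0 rt.
have := grad_drift (j * tau) r w => /(ler_wpM2l (_ : 0 <= 1 + c^-1)) H.
rewrite (le_trans _ (lerD (lexx _) (H _)))//; last by rewrite addr_ge0// invr_ge0 ltW.
rewrite /offmask_sq; apply: normsq_le2 => i.
rewrite divnMDl// divn_small// addn0 mulnK//.
set g := gradf (iter_x (j * tau + r)%N w) i; set g' := gradf _ i.
set s := (U j w i : nat)%:R.
have -> : (1 - s) * g = (1 - s) * g' + (1 - s) * (g - g') by ring.
rewrite (le_trans (sqrD_le_weighted _ _ c0))// lerD2l ler_wpM2l//.
  by rewrite addr_ge0// invr_ge0 ltW.
rewrite exprMn ler_piMl ?sqr_ge0// /s.
by case: (U _ _ _); rewrite /= ?subrr ?subr0 ?expr0n ?expr1n.
Qed.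

(** Drift read backwards: the gradient at a block start is bounded by each later one, so it can be
    averaged over the block. *)
Lemma grad_sq_drift (c : R) q r w : 0 < c ->
  grad_sq q w <= (1 + c) * grad_sq (q + r)%N w
   + (1 + c^-1) * (L ^+ 2 * (r%:R * \sum_(u < r) step_sq (q + u)%N w)).
Proof.
move=> c0; have := grad_drift q r w => /(ler_wpM2l (_ : 0 <= 1 + c^-1)) H.
rewrite (le_trans _ (lerD (lexx _) (H _)))//; last by rewrite addr_ge0// invr_ge0 ltW.
apply: normsq_le2 => i.
set g := gradf (iter_x (q + r)%N w) i; set g' := gradf _ i.
have {1}-> : g' = g + - (g - g') by ring.
by rewrite (le_trans (sqrD_le_weighted _ _ c0))// sqrrN.
Qed.

(** This bound and the three that follow serve integrability, where constants are immaterial. *)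
Lemma onmask_pred_bound t w :
  normsq (fun i => (1 - beta) * mask t w i * (iter_M t w i - gradf (iter_x t w) i))
  <= 2 * normsq (iter_M t w) + 2 * grad_sq t w.
Proof.
move: beta01 => /andP[b0 b1].
apply: normsq_le2 => i; set M := iter_M t w i; set g := gradf _ i.
have H : (M - g) ^+ 2 <= 2 * M ^+ 2 + 2 * g ^+ 2.
  by have := sqr_ge0 (M + g); rewrite !expr2; lra.
rewrite exprMn (le_trans _ H)// ler_piMl ?sqr_ge0//.
case: (U _ _ _); rewrite /= ?mulr1 ?mulr0 ?expr0n//; nra.
Qed.

Lemma momentum_bound t w :
  normsq (iter_M t.+1 w) <= 2 * onmask_err t w + 2 * grad_sq t w.
Proof.
apply: normsq_le2 => i; set g := gradf _ i; have := iter_M_masked t w i.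
set M := iter_M t.+1 w i; case: (U _ _ _) => /=; rewrite ?mul1r => E.
  by have := sqr_ge0 (M - g - g); rewrite !expr2; lra.
by rewrite -E !mul0r expr0n mulr0 add0r mulr_ge0// sqr_ge0.
Qed.

Lemma grad_sq_succ_bound t w :
  grad_sq t.+1 w <= 2 * grad_sq t w + (2 * L ^+ 2) * step_sq t w.
Proof.
have := grad_lipschitz_step t w => /(ler_wpM2l (_ : 0 <= 2 :> R)) H.
rewrite -mulrA (le_trans _ (lerD (lexx _) (H _)))//.
apply: normsq_le2 => i; set g := gradf _ i; set g' := gradf (iter_x t w) i.
by have := sqr_ge0 (g - 2 * g'); rewrite !expr2; lra.
Qed.

Lemma offmask_le t w : offmask_sq t w <= grad_sq t w.
Proof.
apply: normsq_le => i; rewrite exprMn ler_piMl ?sqr_ge0//.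
by case: (U _ _ _); rewrite /= ?subrr ?subr0 ?expr0n ?expr1n.
Qed.

End Paths.

(** * Solving the recursions *)

Lemma sum_block (R : realType) (h : nat -> R) (K tau : nat) :
  \sum_(t < K * tau) h t = \sum_(j < K) \sum_(r < tau) h (j * tau + r)%N.
Proof.
elim: K => [|K IH]; first by rewrite !big_ord0.
rewrite big_ord_recr/= -IH mulSn addnC big_split_ord/=.
by congr (_ + _); apply: eq_bigr => i _.
Qed.

Lemma sum_index_lt (R : realType) (tau : nat) :
  \sum_(r < tau) (r%:R : R) <= tau%:R ^+ 2 / 2.
Proof.
elim: tau => [|tau IH]; first by rewrite big_ord0 mulr_ge0 ?sqr_ge0.
rewrite big_ord_recr/= -natr1; lra.
Qed.

Lemma sum_drift_le (R : realType) (X : nat -> R) (q tau : nat) :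
  (forall t, 0 <= X t) ->
  \sum_(r < tau) r%:R * \sum_(u < r) X (q + u)%N <=
  tau%:R ^+ 2 / 2 * \sum_(u < tau) X (q + u)%N.
Proof.
move=> X0; rewrite (le_trans _ (ler_wpM2r _ (sum_index_lt R tau)))//; last first.
  by apply: sumr_ge0 => u _.
rewrite mulr_suml; apply: ler_sum => r _; rewrite ler_wpM2l//.
rewrite (big_ord_widen tau (fun u => X (q + u)%N) (ltnW (ltn_ord r))) big_mkcond/=.
by apply: ler_sum => u _; case: ifP.
Qed.

Lemma contraction_sum (R : realType) (beta : R) (e b : nat -> R) (T : nat) :
  0 < beta <= 1 -> (forall t, 0 <= e t) ->
  e 0 <= b 0 -> (forall t, e t.+1 <= (1 - beta) * e t + b t.+1) ->
  beta * \sum_(t < T) e t <= \sum_(t < T) b t.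
Proof.
move=> /andP[b0 b1] e0 eb0 eb.
(* The claim is strengthened by the share 1 - beta of the last error, which the next step of the
   recursion consumes. *)
suff : forall T, beta * \sum_(t < T) e t + (1 - beta) * (if T is S t then e t else 0)
    <= \sum_(t < T) b t.
  move=> /(_ T); apply: le_trans; rewrite lerDl.
  by case: T => [|T]; rewrite ?mulr0// mulr_ge0// subr_ge0.
case=> [|{}T]; first by rewrite !big_ord0 !mulr0 addr0.
elim: T => [|T IH]; first by rewrite !big_ord1; lra.
rewrite big_ord_recr [X in _ <= X]big_ord_recr/=.
by have := eb T; lra.
Qed.

(* [a t], [e t], [o t] and [X t] stand for the expectations of |g|^2,
   |S(M - g)|^2, |(1 - S)g|^2 and |x^(t+1) - x^(t)|^2. *)
Section RateFromRecursions.
Context (R : realType) (L eta beta delta s2 Dl : R) (tau K : nat)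
  (a e o X : nat -> R).
Hypotheses (L0 : 0 < L) (eta0 : 0 < eta) (beta01 : 0 < beta <= 1)
  (delta01 : 0 < delta <= 1) (s20 : 0 <= s2) (tau0 : (0 < tau)%N).
Hypotheses (a0 : forall t, 0 <= a t) (e0 : forall t, 0 <= e t)
  (X0 : forall t, 0 <= X t).
Hypothesis Hdescent :
  \sum_(t < K * tau) (eta / 2 * a t + ((2 * eta)^-1 - L / 2) * X t) <=
  Dl + \sum_(t < K * tau) (eta / 2 * (e t + o t)).
Hypothesis Hinit : e 0 <= a 0 + beta ^+ 2 * s2.
Hypothesis Hstep : forall t, e t.+1 <= (1 - beta) * e t + L ^+ 2 / beta * X t
  + (tau %| t.+1)%:R * a t.+1 + beta ^+ 2 * s2.
Hypothesis Hoff : forall c j r, 0 < c -> (r < tau)%N ->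
  o (j * tau + r)%N <= (1 + c) * ((1 - delta) * a (j * tau)%N)
   + (1 + c^-1) * (L ^+ 2 * (r%:R * \sum_(u < r) X (j * tau + u)%N)).
Hypothesis Hdrift : forall c j r, 0 < c ->
  a (j * tau)%N <= (1 + c) * a (j * tau + r)%N
   + (1 + c^-1) * (L ^+ 2 * (r%:R * \sum_(u < r) X (j * tau + u)%N)).
Hypothesis tau_large : 64 / (3 * beta * delta) <= tau%:R.
Hypotheses (eta1 : 4 * L * eta <= 1)
  (eta2 : 80 * L ^+ 2 * eta ^+ 2 <= 3 * delta * beta ^+ 2)
  (eta3 : 80 * tau%:R ^+ 2 * L ^+ 2 * eta ^+ 2 <= 3 * delta).

Let sa := \sum_(t < K * tau) a t.
Let se := \sum_(t < K * tau) e t.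
Let so := \sum_(t < K * tau) o t.
Let sX := \sum_(t < K * tau) X t.
(** Gradients at block starts: fresh masks bring them into [se_le] and [so_le], and [A_le] returns
    them to [sa]. *)
Let A := \sum_(j < K) a (j * tau)%N.
Let W := \sum_(j < K) \sum_(r < tau) r%:R * \sum_(u < r) X (j * tau + u)%N.

Let b0 : 0 < beta. Proof. by case/andP: beta01. Qed.
Let d0 : 0 < delta. Proof. by case/andP: delta01. Qed.
Let d4 : 0 < delta / 4. Proof. by rewrite divr_gt0. Qed.
Let sX0 : 0 <= sX. Proof. by apply: sumr_ge0. Qed.
Let sa0 : 0 <= sa. Proof. by apply: sumr_ge0. Qed.
Let A0 : 0 <= A. Proof. by apply: sumr_ge0. Qed.

Let W_le : W <= tau%:R ^+ 2 / 2 * sX.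
Proof.
rewrite /W /sX sum_block mulr_sumr; apply: ler_sum => j _.
exact: sum_drift_le.
Qed.

Let W0 : 0 <= W.
Proof.
apply: sumr_ge0 => j _; apply: sumr_ge0 => r _; rewrite mulr_ge0//.
exact: sumr_ge0.
Qed.

Let se_le : beta * se <= L ^+ 2 / beta * sX + A + (K * tau)%:R * (beta ^+ 2 * s2).
Proof.
pose b t := (if t is s.+1 then L ^+ 2 / beta * X s else 0)
  + (tau %| t)%:R * a t + beta ^+ 2 * s2.
have : beta * se <= \sum_(t < K * tau) b t.
  apply: contraction_sum => //; first by rewrite /b dvdn0 mul1r add0r.
  by move=> t; have := Hstep t; rewrite /b; lra.
move=> /le_trans; apply; rewrite /b !big_split/=; apply: lerD; last first.
  by rewrite sumr_const card_ord mulr_natl.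
apply: lerD.
  (* The steps enter one index late, so the sum misses its nonnegative last term. *)
  rewrite /sX; case: (K * tau)%N => [|N]; first by rewrite !big_ord0 mulr0.
  rewrite big_ord_recl/= add0r big_ord_recr/= mulrDr mulr_sumr lerDl.
  by rewrite mulr_ge0// divr_ge0 ?sqr_ge0// ltW.
rewrite (sum_block (fun t => (tau %| t)%:R * a t)) /A; apply: ler_sum => j _.
rewrite (bigD1 (Ordinal tau0))//= addn0 dvdn_mull// mul1r big1 ?addr0// => r r0.
rewrite dvdn_addr ?dvdn_mull// gtnNdvd ?mul0r//.
by rewrite lt0n; apply: contraNneq r0 => r0; apply/eqP/val_inj.
Qed.

Let so_le : so <= tau%:R * ((1 + delta / 4) * ((1 - delta) * A))
  + (1 + (delta / 4)^-1) * (L ^+ 2 * W).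
Proof.
rewrite /so sum_block /A /W !mulr_sumr -big_split/=; apply: ler_sum => j _.
apply: le_trans (ler_sum _ (fun r _ => Hoff j d4 (ltn_ord r))) _.
rewrite big_split/= sumr_const card_ord -!mulr_sumr.
by rewrite lerD2r mulr_natl.
Qed.

Let A_le : tau%:R * A <= (1 + delta / 4) * sa + (1 + (delta / 4)^-1) * (L ^+ 2 * W).
Proof.
rewrite /sa sum_block /A /W !mulr_sumr -big_split/=; apply: ler_sum => j _.
have -> : tau%:R * a (j * tau)%N = \sum_(r < tau) a (j * tau)%N.
  by rewrite sumr_const card_ord mulr_natl.
have H (r : 'I_tau) := Hdrift j r d4.
apply: le_trans (ler_sum _ (fun r _ => H r)) _.
by rewrite big_split/= -!mulr_sumr.
Qed.

Lemma rate_from_recursions :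
  sa <= 16 * Dl / (delta * eta) + 32 * beta * s2 / (3 * delta) * (K * tau)%:R.
Proof.
have /andP[dp d1] := delta01; have /andP[bp b1] := beta01.
have [g1 g2 g3] := And3 eta1 eta2 eta3.
have [sX0' sa0' s20'] := And3 sX0 sa0 s20.
pose V := L ^+ 2 * W; pose N : R := (K * tau)%:R.
have V0 : 0 <= V by rewrite mulr_ge0 ?sqr_ge0.
have N0 : 0 <= N by [].
(* 10/delta is 5/delta from [so_le] plus 5/delta from [A_le]; each 5/delta is the bound [dV] on the
   Young factor 1 + 4/delta. *)
have VX : eta ^+ 2 * (10 / delta * V) <= 3 / 16 * sX.
  apply: (@le_trans _ _ (eta ^+ 2 * (10 / delta * (L ^+ 2 * (tau%:R ^+ 2 / 2 * sX))))).
    rewrite ler_wpM2l ?sqr_ge0// ler_wpM2l ?divr_ge0 ?(ltW d0)//.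
    by rewrite /V ler_wpM2l ?sqr_ge0.
  rewrite (_ : _ * _ = 5 * tau%:R ^+ 2 * L ^+ 2 * eta ^+ 2 / delta * sX); last first.
    by field; rewrite gt_eqF.
  rewrite ler_wpM2r// ler_pdivrMr//. lra.
have LX : eta ^+ 2 * (L ^+ 2 / beta ^+ 2 * sX) <= 3 / 80 * sX.
  rewrite mulrA ler_wpM2r// mulrA ler_pdivrMr ?exprn_gt0//.
  have : delta * beta ^+ 2 <= 1 * beta ^+ 2 by rewrite ler_wpM2r ?sqr_ge0.
  lra.
(* The size of [tau] makes the cost of fresh masks, amplified by 1/beta, a small multiple of
   delta. *)
have Ab : A / beta <= 3 * delta / 64 * (tau%:R * A).
  rewrite mulrA (mulrC A) ler_wpM2r//.
  move: tau_large; rewrite ler_pdivrMr ?mulr_gt0// => H.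
  rewrite -(@ler_pM2r _ beta)// mulVf ?gt_eqF//; lra.
have se_le' : se <= L ^+ 2 / beta ^+ 2 * sX + A / beta + N * (beta * s2).
  rewrite -(@ler_pM2l _ beta)// (le_trans se_le)// le_eqVlt; apply/orP; left.
  by apply/eqP; rewrite /N; field; rewrite gt_eqF.
have dV : (1 + (delta / 4)^-1) * V <= 5 / delta * V.
  rewrite ler_wpM2r// (_ : (delta / 4)^-1 = 4 / delta); last first.
    by field; rewrite gt_eqF.
  have : 1 <= delta^-1 by rewrite invf_ge1.
  lra.
(* Young's inequality with weight delta/4, for which (1 + delta/4) kappa <= 1 - delta/8. *)
pose kappa := (1 + delta / 4) * (1 - delta) + 3 * delta / 64.
have k0 : 0 <= kappa by rewrite /kappa; nra.
have k1 : kappa <= 1 - 45 / 64 * delta.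
  rewrite /kappa; have := sqr_ge0 delta; lra.
have main : se + so <= (1 - delta / 8) * sa + 10 / delta * V
    + L ^+ 2 / beta ^+ 2 * sX + N * (beta * s2).
  have h1 : kappa * (tau%:R * A) <= (1 - delta / 8) * sa + 5 / delta * V.
    apply: (@le_trans _ _ (kappa * ((1 + delta / 4) * sa + 5 / delta * V))).
      by rewrite ler_wpM2l// (le_trans A_le)// lerD2l.
    rewrite mulrDr; apply: lerD.
      by rewrite mulrA ler_wpM2r//; nra.
    rewrite ler_piMl//; last by lra.
    by apply: mulr_ge0 => //; rewrite divr_ge0// ltW.
  have := so_le; rewrite -/V; move: h1 se_le' Ab dV.
  rewrite /kappa; lra.
have Hd : sa + (1 - eta * L) / eta ^+ 2 * sX <= 2 * Dl / eta + (se + so).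
  rewrite -(@ler_pM2l _ (eta / 2)) ?divr_gt0//.
  rewrite (_ : _ / _ * (sa + _) = eta / 2 * sa + ((2 * eta)^-1 - L / 2) * sX); last first.
    by field; rewrite gt_eqF.
  rewrite (_ : _ / _ * (_ + (se + so)) = Dl + eta / 2 * (se + so)); last first.
    by field; rewrite gt_eqF.
  move: Hdescent; rewrite big_split/= -!mulr_sumr big_split/=; exact.
(* In units of sX / eta^2, at least 3/4 is available by [eta1], against 3/16 + 3/80 spent on
   drift. *)
have fin : 10 / delta * V + L ^+ 2 / beta ^+ 2 * sX <= (1 - eta * L) / eta ^+ 2 * sX.
  rewrite -(@ler_pM2l _ (eta ^+ 2)) ?exprn_gt0//.
  rewrite (_ : _ * (_ / _ * sX) = (1 - eta * L) * sX); last by field; rewrite gt_eqF.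
  have : 4 * L * eta * sX <= 1 * sX by rewrite ler_wpM2r.
  rewrite mulrDr; lra.
have last1 : delta / 8 * sa <= 2 * Dl / eta + N * (beta * s2) by lra.
have : sa <= 8 / delta * (2 * Dl / eta + N * (beta * s2)).
  by rewrite mulrAC ler_pdivlMr//; lra.
move=> /le_trans; apply.
have -> : 8 / delta * (2 * Dl / eta + N * (beta * s2)) =
    16 * Dl / (delta * eta) + 8 * (N * beta * s2 / delta).
  by field; rewrite !gt_eqF.
have -> : 32 * beta * s2 / (3 * delta) * (K * tau)%:R = 32 / 3 * (N * beta * s2 / delta).
  by rewrite /N; field; rewrite !gt_eqF.
(* The noise coefficient obtained is 8, below the required 32/3. *)
rewrite lerD2l ler_wpM2r//; last by lra.
by rewrite divr_ge0 ?mulr_ge0 ?(ltW d0) ?(ltW b0).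
Qed.
End RateFromRecursions.

(** * Recursions in expectation *)

Section ExpectedRecursions.
Context (R : realType) (NL : nat) (m n k : 'I_NL -> nat)
  (dX : measure_display) (Xi : measurableType dX) (D : probability Xi R)
  (f : (pcoord m n -> R) -> R)
  (gradf : (pcoord m n -> R) -> pcoord m n -> R)
  (G : (pcoord m n -> R) -> Xi -> pcoord m n -> R) (L : R) (sig : 'I_NL -> R)
  (dO : measure_display) (Om : measurableType dO) (P : probability Om R)
  (xi : nat -> Om -> Xi) (U : nat -> Om -> {ffun pcoord m n -> bool})
  (x0 : pcoord m n -> R) (beta eta : R) (tau : nat).
Hypothesis gf : is_gradient f gradf.
Hypothesis A1 : Assumption1 f.
Hypothesis A2 : Assumption2 gradf L.
Hypothesis L0 : 0 < L.
Hypothesis A3 : Assumption3 D G gradf sig.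
Hypothesis mG : jointly_measurable G.
Hypothesis HS : sampling_model D k P xi U.
Hypothesis Hk : forall l, (0 < k l /\ k l < m l * n l)%N.
Hypothesis beta01 : 0 < beta <= 1.
Hypothesis eta0 : 0 < eta.
Hypothesis tau0 : (0 < tau)%N.

Notation iter_x t w := (gosare_state G xi U x0 beta eta tau w t).1.
Notation iter_M t w := (gosare_state G xi U x0 beta eta tau w t).2.
Notation mask t w i := ((U (t %/ tau)%N w i : nat)%:R : R).
Notation ga := (grad_sq gradf G xi U x0 beta eta tau).
Notation er := (onmask_err gradf G xi U x0 beta eta tau).
Notation off := (offmask_sq gradf G xi U x0 beta eta tau).
Notation dx := (step_sq G xi U x0 beta eta tau).
Notation ig h := (P.-integrable setT (EFin \o h)).
Notation Ex h := (\int[P]_w h w).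

Let mx t i : measurable_fun setT (fun w => iter_x t w i).
Proof. by case: (measurable_iter x0 beta eta tau mG HS t i). Qed.

Let mM t i : measurable_fun setT (fun w => iter_M t w i).
Proof. by case: (measurable_iter x0 beta eta tau mG HS t i). Qed.

Let mg t i : measurable_fun setT (fun w => gradf (iter_x t w) i).
Proof. exact: (measurable_grad x0 beta eta tau A3 mG HS). Qed.

Let mmask t i : measurable_fun setT (fun w => mask t w i).
Proof. exact: (measurable_mask tau HS). Qed.

Let mga t : measurable_fun setT (ga t).
Proof. by apply: measurable_normsq. Qed.

Let mM2 t : measurable_fun setT (fun w => normsq (iter_M t w)).
Proof. by apply: measurable_normsq. Qed.

Let mer t : measurable_fun setT (er t).
Proof.
by apply: measurable_normsq => i; apply: measurable_funM => //; exact: measurable_funB.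
Qed.

Let moff t : measurable_fun setT (off t).
Proof.
by apply: measurable_normsq => i; apply: measurable_funM => //; exact: measurable_funB.
Qed.

Let mdx t : measurable_fun setT (dx t).
Proof. by apply: measurable_normsq => i; exact: measurable_funB. Qed.

(** The on-mask error at step t before the noise of xi^(t) is added. *)
Let pre t w := normsq (fun i => (1 - beta) * mask t w i *
  (iter_M t w i - gradf (iter_x t w) i)).

Let mpre t : measurable_fun setT (pre t).
Proof.
apply: measurable_normsq => i; apply: measurable_funM; last exact: measurable_funB.
exact: measurable_funM.
Qed.

Let ig2 (c1 c2 : R) h1 h2 : ig h1 -> ig h2 -> ig (fun w => c1 * h1 w + c2 * h2 w).
Proof. by move=> i1 i2; apply: integrable_EFinD; exact: integrable_EFinZl. Qed.

Let Ex2 (c1 c2 : R) h1 h2 : ig h1 -> ig h2 ->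
  Ex (fun w => c1 * h1 w + c2 * h2 w) = c1 * Ex h1 + c2 * Ex h2.
Proof.
by move=> i1 i2; rewrite RintegralD ?RintegralZl//; exact: integrable_EFinZl.
Qed.

(** [noise_step] compares extended reals, so a finite right-hand side is what makes the new error
    integrable. *)
Let noise_integrable t : ig (pre t) ->
  ig (er t) /\ Ex (er t) <= Ex (pre t) + beta ^+ 2 * sigma2 sig.
Proof.
move=> ipre; have H := noise_step x0 beta eta tau A3 mG HS t.
rewrite [X in (_ <= X + _)%E](EFin_Rintegral ipre) -EFinD in H.
have ier : ig (er t).
  apply: integrable_EFin_lty => //; first by move=> w; exact: normsq_ge0.
  by apply: le_lt_trans H _; exact: ltry.
by split => //; rewrite -lee_fin -EFin_Rintegral.
Qed.

(** The two are coupled: gradient and old momentum control [pre], hence the error, the new momentum,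
    the step and the next gradient. The start is deterministic. *)
Let integrable_iterates t : ig (ga t) /\ ig (fun w => normsq (iter_M t w)).
Proof.
elim: t => [|t [iga iM]].
  split; first exact: (integrable_EFin_cst P (normsq (gradf x0))).
  exact: (integrable_EFin_cst P (normsq (fun=> 0 : R))).
have ipre : ig (pre t).
  apply: (integrable_EFin_le _ _ (ig2 2 2 iM iga)) => // w.
  by rewrite normsq_ge0 /= onmask_pred_bound.
have [ier _] := noise_integrable ipre.
have iM' : ig (fun w => normsq (iter_M t.+1 w)).
  apply: (integrable_EFin_le _ _ (ig2 2 2 ier iga)) => // w.
  by rewrite normsq_ge0 momentum_bound.
split => //.
apply: (integrable_EFin_le _ _ (ig2 2 (2 * L ^+ 2 * eta ^+ 2) iga iM')) => // w.
rewrite normsq_ge0/= (le_trans (grad_sq_succ_bound _ _ _ _ _ _ _ A2 L0 _ _))//.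
by rewrite step_sqE lerD2l mulrA.
Qed.

Lemma integrable_grad_sq t : ig (ga t).
Proof. by case: (integrable_iterates t). Qed.

Let ipre t : ig (pre t).
Proof.
have [iga iM] := integrable_iterates t.
apply: (integrable_EFin_le _ _ (ig2 2 2 iM iga)) => // w.
by rewrite normsq_ge0 /= onmask_pred_bound.
Qed.

Let ier t : ig (er t). Proof. by case: (noise_integrable (ipre t)). Qed.

Let ioff t : ig (off t).
Proof.
apply: (integrable_EFin_le _ _ (integrable_grad_sq t)) => // w.
by rewrite normsq_ge0 offmask_le.
Qed.

Let idx t : ig (dx t).
Proof.
have [_ iM] := integrable_iterates t.+1.
rewrite (_ : dx t = fun w => eta ^+ 2 * normsq (iter_M t.+1 w)).
  exact: integrable_EFinZl.
by apply/funext => w; rewrite step_sqE.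
Qed.

Lemma expected_descent T :
  \sum_(t < T) (eta / 2 * Ex (ga t) + ((2 * eta)^-1 - L / 2) * Ex (dx t)) <=
  Delta f x0 + \sum_(t < T) (eta / 2 * (Ex (er t) + Ex (off t))).
Proof.
have i1 (t : 'I_T) : ig (fun w => eta / 2 * ga t w + ((2 * eta)^-1 - L / 2) * dx t w).
  by apply: ig2 => //; exact: integrable_grad_sq.
have i2 (t : 'I_T) : ig (fun w => eta / 2 * (er t w + off t w)).
  by apply: integrable_EFinZl; exact: integrable_EFinD.
rewrite [leLHS](_ : _ = Ex (fun w => \sum_(t < T)
    (eta / 2 * ga t w + ((2 * eta)^-1 - L / 2) * dx t w))); last first.
  rewrite Rintegral_sum//; apply: eq_bigr => t _.
  by rewrite Ex2//; exact: integrable_grad_sq.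
rewrite [leRHS](_ : _ = Ex (fun w => Delta f x0 + \sum_(t < T) (eta / 2 * (er t w + off t w)))).
  apply: le_Rintegral => //.
  - exact: integrable_EFin_sum.
  - by apply: integrable_EFinD; [exact: integrable_EFin_cst|exact: integrable_EFin_sum].
  - by move=> w _; exact: descent_sum.
rewrite RintegralD//; [|exact: integrable_EFin_cst|exact: integrable_EFin_sum].
rewrite Rintegral_prob_cst Rintegral_sum//; congr (_ + _); apply: eq_bigr => t _.
by rewrite RintegralZl ?RintegralD//; exact: integrable_EFinD.
Qed.

Lemma expected_onmask_init : Ex (er 0) <= Ex (ga 0) + beta ^+ 2 * sigma2 sig.
Proof.
have [_ /le_trans] := noise_integrable (ipre 0); apply; rewrite lerD2r.
apply: le_Rintegral => //; first exact: integrable_grad_sq.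
by move=> w _; exact: onmask_init_le.
Qed.

Lemma expected_onmask_step t :
  Ex (er t.+1) <= (1 - beta) * Ex (er t) + L ^+ 2 / beta * Ex (dx t)
    + (tau %| t.+1)%:R * Ex (ga t.+1) + beta ^+ 2 * sigma2 sig.
Proof.
have [_ /le_trans] := noise_integrable (ipre t.+1); apply; rewrite lerD2r.
rewrite -Ex2// -[X in _ <= X + _]mul1r -Ex2//; last exact: integrable_grad_sq; last exact: ig2.
apply: le_Rintegral => //.
  by apply: ig2; [exact: ig2|exact: integrable_grad_sq].
by move=> w _; rewrite mul1r; exact: onmask_pred_le.
Qed.

Let idrift q r : ig (fun w => \sum_(u < r) dx (q + u)%N w).
Proof. exact: integrable_EFin_sum. Qed.

Lemma expected_grad_drift (c : R) j r : 0 < c ->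
  Ex (ga (j * tau)%N) <= (1 + c) * Ex (ga (j * tau + r)%N)
   + (1 + c^-1) * (L ^+ 2 * (r%:R * \sum_(u < r) Ex (dx (j * tau + u)%N))).
Proof.
move=> c0; rewrite -Rintegral_sum// 2!mulrA -Ex2//; last exact: integrable_grad_sq.
apply: le_Rintegral => //; first exact: integrable_grad_sq.
  by apply: ig2 => //; exact: integrable_grad_sq.
move=> w _; have := grad_sq_drift G xi U x0 beta eta tau A2 L0 (j * tau) r w c0.
by rewrite !mulrA.
Qed.

Lemma delta_min_le l : delta_min m n k <= delta m n k l :> R.
Proof. by rewrite /delta_min (bigminD1 l)// ge_min lexx. Qed.

Lemma delta_min_gt0_le1 : 0 < (delta_min m n k : R) <= 1.
Proof.
apply/andP; split; last exact: bigmin_le_id.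
apply: (big_ind (fun x : R => 0 < x)) => // [x y x0' y0|l _]; first by rewrite lt_min x0' y0.
have [k0 kmn] := Hk l.
by rewrite /delta divr_gt0 ?ltr0n// (leq_ltn_trans _ kmn).
Qed.

(** The factor 1 - S is 0 or 1, hence its own square, so the norm splits into the coordinates
    handled by [offmask_coord]. *)
Let expected_offmask_start j :
  Ex (off (j * tau)%N) <= (1 - delta_min m n k) * Ex (ga (j * tau)%N).
Proof.
pose gi i w := gradf (iter_x (j * tau)%N w) i ^+ 2.
have igi i : ig (gi i).
  apply: (integrable_EFin_le _ _ (integrable_grad_sq (j * tau)%N)).
    exact: measurable_funX.
  move=> w; rewrite sqr_ge0 /grad_sq /normsq (bigD1 i)//= lerDl.
  by apply: sumr_ge0 => *; exact: sqr_ge0.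
have iki i : ig (fun w => (1 - mask (j * tau)%N w i) * gi i w).
  apply: (integrable_EFin_le _ _ (igi i)).
    by apply: measurable_funM; [exact: measurable_funB|exact: measurable_funX].
  move=> w; rewrite /gi; case: (U _ _ _); rewrite /= ?subrr ?subr0 ?mul0r ?mul1r ?lexx ?sqr_ge0//.
rewrite (_ : off (j * tau)%N = fun w => \sum_i (1 - mask (j * tau)%N w i) * gi i w); last first.
  apply/funext => w; apply: eq_bigr => i _; rewrite exprMn; congr (_ * _).
  by case: (U _ _ _); rewrite /= ?subrr ?subr0 ?expr0n ?expr1n.
rewrite [X in _ <= _ * X](_ : _ = \sum_i Ex (gi i)); last by rewrite -Rintegral_sum.
rewrite Rintegral_sum// mulr_sumr; apply: ler_sum => i _.
have [k0 kmn] := Hk (tag i).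
have := offmask_coord x0 beta eta A3 mG HS tau0 (dvdn_mull j (dvdnn tau))
  (leq_ltn_trans (leq0n _) kmn : (0 < m (tag i) * n (tag i))%N).
rewrite (EFin_Rintegral (iki i)) (EFin_Rintegral (igi i)) -EFinM => -[->].
rewrite ler_wpM2r ?lerD2l ?lerN2 ?delta_min_le//.
by apply: Rintegral_ge0 => w _; exact: sqr_ge0.
Qed.

Lemma expected_offmask (c : R) j r : 0 < c -> (r < tau)%N ->
  Ex (off (j * tau + r)%N) <= (1 + c) * ((1 - delta_min m n k) * Ex (ga (j * tau)%N))
   + (1 + c^-1) * (L ^+ 2 * (r%:R * \sum_(u < r) Ex (dx (j * tau + u)%N))).
Proof.
move=> c0 rt.
apply: (@le_trans _ _ ((1 + c) * Ex (off (j * tau)%N) +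
   (1 + c^-1) * (L ^+ 2 * (r%:R * \sum_(u < r) Ex (dx (j * tau + u)%N))))); last first.
  by rewrite lerD2r ler_wpM2l// addr_ge0// ltW.
rewrite -Rintegral_sum// 2!mulrA -Ex2//.
apply: le_Rintegral => //; first exact: ig2.
move=> w _; have := offmask_drift G xi U x0 beta eta A2 L0 tau0 j w c0 rt.
by rewrite !mulrA.
Qed.

End ExpectedRecursions.

(** * The rate for an arbitrary horizon *)

Section Rate.
Context (R : realType) (NL : nat) (m n k : 'I_NL -> nat)
  (dX : measure_display) (Xi : measurableType dX) (D : probability Xi R)
  (f : (pcoord m n -> R) -> R)
  (gradf : (pcoord m n -> R) -> pcoord m n -> R)
  (G : (pcoord m n -> R) -> Xi -> pcoord m n -> R) (L : R) (sig : 'I_NL -> R)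
  (dO : measure_display) (Om : measurableType dO) (P : probability Om R)
  (xi : nat -> Om -> Xi) (U : nat -> Om -> {ffun pcoord m n -> bool})
  (x0 : pcoord m n -> R) (beta eta : R) (tau : nat).
Hypotheses (gf : is_gradient f gradf) (A1 : Assumption1 f)
  (A2 : Assumption2 gradf L) (L0 : 0 < L) (A3 : Assumption3 D G gradf sig)
  (mG : jointly_measurable G) (HS : sampling_model D k P xi U)
  (Hk : forall l, (0 < k l /\ k l < m l * n l)%N)
  (beta01 : 0 < beta <= 1) (eta0 : 0 < eta).
Local Notation dlt := (delta_min m n k : R).
Hypotheses (tau_large : 64 / (3 * beta * dlt) <= tau%:R)
  (eta1 : 4 * L * eta <= 1)
  (eta2 : 80 * L ^+ 2 * eta ^+ 2 <= 3 * dlt * beta ^+ 2)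
  (eta3 : 80 * tau%:R ^+ 2 * L ^+ 2 * eta ^+ 2 <= 3 * dlt).

(** A horizon that is not a multiple of [tau] is extended to complete blocks, which only adds
    nonnegative terms. *)
Lemma sum_Egradsq_le T K : (T <= K * tau)%N ->
  (\sum_(t < T) Egradsq P gradf (gosare_x G xi U x0 beta eta tau t) <=
   (16 * Delta f x0 / (dlt * eta)
    + 32 * beta * sigma2 sig / (3 * dlt) * (K * tau)%:R)%:E)%E.
Proof.
move=> TK; have d01 : 0 < dlt <= 1 by apply: delta_min_gt0_le1.
have tau0 : (0 < tau)%N.
  rewrite -(ltr0n R) (lt_le_trans _ tau_large)// divr_gt0// mulr_gt0//.
    by rewrite mulr_gt0//; case/andP: beta01.
  by case/andP: d01.
pose a t := \int[P]_w grad_sq gradf G xi U x0 beta eta tau t w.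
have a_ge0 t : 0 <= a t by apply: Rintegral_ge0 => w _; exact: normsq_ge0.
rewrite (eq_bigr (fun t : 'I_T => (a t)%:E)) => [|t _]; last first.
  rewrite -EFin_Rintegral//.
  exact: (integrable_grad_sq x0 eta tau A2 L0 A3 mG HS beta01).
rewrite sumEFin lee_fin (@le_trans _ _ (\sum_(t < K * tau) a t))//.
  rewrite (big_ord_widen _ a TK) big_mkcond/=.
  by apply: ler_sum => t _; case: ifP.
apply: (@rate_from_recursions _ L eta beta dlt (sigma2 sig) (Delta f x0) tau K a
  (fun t => \int[P]_w onmask_err gradf G xi U x0 beta eta tau t w)
  (fun t => \int[P]_w offmask_sq gradf G xi U x0 beta eta tau t w)
  (fun t => \int[P]_w step_sq G xi U x0 beta eta tau t w)) => //.
- by apply: sumr_ge0 => l _; exact: sqr_ge0.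
- by move=> t; apply: Rintegral_ge0 => w _; exact: normsq_ge0.
- by move=> t; apply: Rintegral_ge0 => w _; exact: normsq_ge0.
- exact: (expected_descent x0 tau gf A1 A2 L0 A3 mG HS beta01 eta0).
- exact: (expected_onmask_init x0 eta tau A2 L0 A3 mG HS beta01).
- exact: (expected_onmask_step x0 eta A2 L0 A3 mG HS beta01 tau0).
- move=> c j r c0 rt.
  exact: (expected_offmask x0 eta A2 L0 A3 mG HS Hk beta01 tau0 _ c0 rt).
- move=> c j r c0.
  exact: (expected_grad_drift x0 eta tau A2 L0 A3 mG HS beta01 _ _ c0).
Qed.
End Rate.

(** * Tuned parameters *)

Section TunedParameters.
Context (R : realType) (L dlt s2 Dl beta eta : R) (T tau : nat).
Hypotheses (L0 : 0 < L) (d01 : 0 < dlt <= 1) (s20 : 0 <= s2) (Dl0 : 0 < Dl).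
Hypothesis HT : 2 + 128 / (3 * dlt)
  + (128 ^+ 2 * s2) / (9 * Num.sqrt dlt * L * Dl) <= T%:R.
Hypothesis betaE :
  beta = (1 + Num.sqrt (dlt * Num.sqrt dlt * s2 * T%:R / (L * Dl)))^-1.
Hypothesis tauE : (tau : int) = Num.ceil (64 / (3 * dlt * beta)).
Hypothesis etaE :
  eta = (4 * L + Num.sqrt (80 * L ^+ 2 / (3 * dlt * beta ^+ 2))
              + Num.sqrt (80 * tau%:R ^+ 2 * L ^+ 2 / (3 * dlt))
              + Num.sqrt (16 * tau%:R * L ^+ 2 / (3 * beta)))^-1.

(** With delta = r^2 and 1/beta = 1 + y, all the quantities below become rational expressions. *)
Let r := Num.sqrt dlt.
Let y := Num.sqrt (dlt * r * s2 * T%:R / (L * Dl)).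
Let d0 : 0 < dlt. Proof. by case/andP: d01. Qed.
Let d1 : dlt <= 1. Proof. by case/andP: d01. Qed.
Let r0 : 0 < r. Proof. by rewrite sqrtr_gt0. Qed.
Let rr : dlt = r ^+ 2. Proof. by rewrite sqr_sqrtr// ltW. Qed.
Let r1 : r <= 1. Proof. by rewrite -sqrtr1 ler_wsqrtr. Qed.
Let y0 : 0 <= y. Proof. exact: sqrtr_ge0. Qed.
Let yy : y ^+ 2 = dlt * r * s2 * T%:R / (L * Dl).
Proof.
rewrite sqr_sqrtr// divr_ge0 ?mulr_ge0 ?(ltW d0) ?(ltW r0) ?(ltW L0) ?(ltW Dl0)//.
Qed.

Let T0 : 0 < T%:R :> R.
Proof.
have A : 0 <= 128 / (3 * dlt) by rewrite divr_ge0// mulr_ge0// ltW.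
have B : 0 <= 128 ^+ 2 * s2 / (9 * r * L * Dl).
  by rewrite divr_ge0 ?mulr_ge0 ?exprn_ge0 ?(ltW r0) ?(ltW L0) ?(ltW Dl0).
have := HT; rewrite -/r; lra.
Qed.

Lemma beta_gt0_le1 : 0 < beta <= 1.
Proof.
have y1 : 1 <= 1 + y by rewrite lerDl.
by rewrite betaE invr_gt0 (lt_le_trans _ y1)//= invf_le1// (lt_le_trans _ y1).
Qed.

Let b0 : 0 < beta. Proof. by case/andP: beta_gt0_le1. Qed.
Let b1 : beta <= 1. Proof. by case/andP: beta_gt0_le1. Qed.
Let bV : beta^-1 = 1 + y. Proof. by rewrite betaE invrK. Qed.

Let tau_itv : 64 / (3 * dlt * beta) <= tau%:R < 64 / (3 * dlt * beta) + 1.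
Proof.
have := ceil_itv (64 / (3 * dlt * beta)); rewrite -tauE intrB -pmulrn => /andP[h1 h2].
by rewrite h2 -ltrBlDr.
Qed.

Lemma tau_ge : 64 / (3 * beta * dlt) <= tau%:R.
Proof. by case/andP: tau_itv; rewrite mulrAC. Qed.

(** The lower bound on T is used here. With [a] its noise term, the part of [tau] proportional to
    [y] is at most sqrt(a T) / 2 <= (a + T) / 4, and the rest, 64 / (3 delta) + 1, is at most (T -
    a) / 2. *)
Lemma tau_le_T : (tau <= T)%N.
Proof.
rewrite -(ler_nat R); case/andP: tau_itv => _ /ltW/le_trans; apply.
have -> : 64 / (3 * dlt * beta) = 64 / (3 * dlt) + 64 / (3 * dlt) * y.
  have -> : 64 / (3 * dlt * beta) = 64 / (3 * dlt) * beta^-1 by field; rewrite !gt_eqF.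
  by rewrite bV; ring.
set a := 128 ^+ 2 * s2 / (9 * r * L * Dl).
have a0 : 0 <= a.
  by rewrite divr_ge0 ?mulr_ge0 ?exprn_ge0 ?(ltW r0) ?(ltW L0) ?(ltW Dl0).
have T0' := T0.
have H : 64 / (3 * dlt) * y <= (a + T%:R) / 4.
  rewrite -(@ler_pXn2r _ 2)// ?nnegrE; last 2 first.
  - by rewrite mulr_ge0 ?divr_ge0 ?mulr_ge0 ?(ltW d0).
  - by rewrite divr_ge0 ?addr_ge0 ?(ltW T0).
  rewrite exprMn yy.
  have -> : (64 / (3 * dlt)) ^+ 2 * (dlt * r * s2 * T%:R / (L * Dl)) = a * T%:R / 4.
    by rewrite /a rr; field; rewrite !gt_eqF.
  have := sqr_ge0 (a - T%:R); rewrite !expr2; lra.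
have := HT; rewrite -/r -/a (_ : 128 / (3 * dlt) = 2 * (64 / (3 * dlt))); last first.
  by field; rewrite gt_eqF.
lra.
Qed.

(** Rounding up costs 1 <= 1 / (delta beta), and 64/3 + 1 <= 23. *)
Let tau_le : tau%:R <= 23 / (dlt * beta).
Proof.
case/andP: tau_itv => _ /ltW/le_trans; apply.
have : 1 <= (dlt * beta)^-1.
  by rewrite invf_ge1 ?mulr_gt0// mulr_ile1 ?(ltW d0) ?(ltW b0).
have -> : 64 / (3 * dlt * beta) = 64 / 3 * (dlt * beta)^-1.
  by field; rewrite !gt_eqF.
lra.
Qed.

Let tau_gt0 : 0 < tau%:R :> R.
Proof.
case/andP: tau_itv => h _; apply: lt_le_trans h.
by rewrite divr_gt0 ?mulr_gt0.
Qed.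

Let S1 := Num.sqrt (80 * L ^+ 2 / (3 * dlt * beta ^+ 2)).
Let S2 := Num.sqrt (80 * tau%:R ^+ 2 * L ^+ 2 / (3 * dlt)).
Let S3 := Num.sqrt (16 * tau%:R * L ^+ 2 / (3 * beta)).

Let etaV : eta^-1 = 4 * L + S1 + S2 + S3.
Proof. by rewrite etaE invrK. Qed.

(** Each summand of 1/eta enforces one step-size condition. *)
Let etaV_ge : [/\ 4 * L <= eta^-1, S1 <= eta^-1 & S2 <= eta^-1].
Proof.
have [h1 h2 h3] := And3 (sqrtr_ge0 _ : 0 <= S1) (sqrtr_ge0 _ : 0 <= S2) (sqrtr_ge0 _ : 0 <= S3).
have L0' := L0.
by rewrite etaV; split; lra.
Qed.

Lemma eta_gt0 : 0 < eta.
Proof.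
rewrite -invr_gt0; case: etaV_ge => h _ _; apply: lt_le_trans h.
by rewrite mulr_gt0.
Qed.

Let e0 := eta_gt0.

Lemma eta_le1 : 4 * L * eta <= 1.
Proof. by case: etaV_ge => h _ _; rewrite -ler_pdivlMr// mul1r. Qed.

Let eta_sqrt (x : R) : 0 <= x -> Num.sqrt x <= eta^-1 -> x * eta ^+ 2 <= 1.
Proof.
move=> x0 h; rewrite -ler_pdivlMr ?exprn_gt0// mul1r -exprVn.
by rewrite -[leLHS]sqr_sqrtr// ler_pXn2r ?nnegrE ?sqrtr_ge0 ?invr_ge0 ?(ltW e0).
Qed.

Lemma eta_le2 : 80 * L ^+ 2 * eta ^+ 2 <= 3 * dlt * beta ^+ 2.
Proof.
have p0 : 0 < 3 * dlt * beta ^+ 2 by rewrite mulr_gt0 ?exprn_gt0// mulr_gt0.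
have q0 : 0 <= 80 * L ^+ 2 / (3 * dlt * beta ^+ 2).
  by rewrite divr_ge0 ?(ltW p0)// mulr_ge0 ?sqr_ge0.
case: etaV_ge => _ h _; have := eta_sqrt q0 h.
by rewrite mulrAC ler_pdivrMr// mul1r.
Qed.

Lemma eta_le3 : 80 * tau%:R ^+ 2 * L ^+ 2 * eta ^+ 2 <= 3 * dlt.
Proof.
have p0 : 0 < 3 * dlt by rewrite mulr_gt0.
have q0 : 0 <= 80 * tau%:R ^+ 2 * L ^+ 2 / (3 * dlt).
  by rewrite divr_ge0 ?(ltW p0)// !mulr_ge0 ?(ltW L0).
case: etaV_ge => _ _ h; have := eta_sqrt q0 h.
by rewrite mulrAC ler_pdivrMr// mul1r.
Qed.

Let Q := L / (dlt * r * beta).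

Let Q0 : 0 <= Q.
Proof.
by rewrite divr_ge0 ?mulr_ge0 ?(ltW d0) ?(ltW r0) ?(ltW b0) ?(ltW L0).
Qed.

Let drb_le1 : dlt * r * beta <= 1.
Proof. by rewrite !mulr_ile1 ?mulr_ge0 ?(ltW d0) ?(ltW r0) ?(ltW b0). Qed.

(** [Q] is the order of [S2] once [tau] is of order 1 / (delta beta); it dominates the other
    summands, and 160 = 4 + 6 + 138 + 12. *)
Let etaV_le : eta^-1 <= 160 * Q.
Proof.
have sq (x z : R) : 0 <= z -> x <= z ^+ 2 -> Num.sqrt x <= z.
  by move=> z0 xz; rewrite -[leRHS]ger0_norm// -sqrtr_sqr ler_wsqrtr.
have drb0 : 0 < dlt * r * beta by rewrite !mulr_gt0.
have h0 : L <= Q by rewrite ler_pdivlMr// ler_piMr// ltW.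
have h1 : S1 <= 6 * Q.
  apply: sq; first by rewrite mulr_ge0.
  rewrite ler_pdivrMr ?mulr_gt0 ?exprn_gt0//.
  have -> : (6 * Q) ^+ 2 * (3 * dlt * beta ^+ 2) = 108 * L ^+ 2 / dlt ^+ 2.
    by rewrite /Q rr; field; rewrite !gt_eqF.
  rewrite ler_pdivlMr ?exprn_gt0//.
  have : L ^+ 2 * dlt ^+ 2 <= L ^+ 2 by rewrite ler_piMr ?sqr_ge0// expr_le1// ltW.
  have := sqr_ge0 L; lra.
have h2 : S2 <= 138 * Q.
  apply: sq; first by rewrite mulr_ge0.
  apply: (@le_trans _ _ (80 * (23 / (dlt * beta)) ^+ 2 * L ^+ 2 / (3 * dlt))).
    rewrite ler_wpM2r ?invr_ge0 ?mulr_ge0 ?(ltW d0)// ler_wpM2r ?sqr_ge0//.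
    rewrite ler_wpM2l// ler_pXn2r ?nnegrE ?(ltW tau_gt0)//.
    by rewrite divr_ge0// mulr_ge0// ltW.
  have -> : 80 * (23 / (dlt * beta)) ^+ 2 * L ^+ 2 / (3 * dlt) =
      80 * 23 ^+ 2 / 3 * Q ^+ 2.
    by rewrite /Q rr; field; rewrite !gt_eqF.
  have := sqr_ge0 Q; lra.
have h3 : S3 <= 12 * Q.
  apply: sq; first by rewrite mulr_ge0.
  apply: (@le_trans _ _ (16 * (23 / (dlt * beta)) * L ^+ 2 / (3 * beta))).
    rewrite ler_wpM2r ?invr_ge0 ?mulr_ge0 ?(ltW b0)// ler_wpM2r ?sqr_ge0//.
    by rewrite ler_wpM2l.
  have -> : 16 * (23 / (dlt * beta)) * L ^+ 2 / (3 * beta) =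
      16 * 23 / 3 * (Q ^+ 2 * dlt ^+ 2).
    by rewrite /Q rr; field; rewrite !gt_eqF.
  have : Q ^+ 2 * dlt ^+ 2 <= Q ^+ 2 by rewrite ler_piMr ?sqr_ge0// expr_le1// ltW.
  have := sqr_ge0 Q; lra.
rewrite etaV; lra.
Qed.

(** The second target term is Z y. Since 1/beta = 1 + y, the first part of the bound is a multiple
    of Z + Z y; since beta y <= 1, the noise part is a multiple of Z y. The factors are 2560 = 16 *
    160 and 64/3, which fit in 2600. *)
Lemma tuned_rate (N : R) : 0 <= N <= 2 * T%:R ->
  T%:R^-1 * (16 * Dl / (dlt * eta) + 32 * beta * s2 / (3 * dlt) * N) <=
  2600 * (L * Dl / (dlt ^+ 2 * Num.sqrt dlt * T%:R)
    + Num.sqrt (L * Dl * s2 / (dlt ^+ 3 * Num.sqrt dlt * T%:R))).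
Proof.
move=> /andP[N0 NT]; rewrite -/r.
set Z := L * Dl / (dlt ^+ 2 * r * T%:R); set Y := Num.sqrt _.
have Z0 : 0 <= Z.
  by rewrite divr_ge0 ?mulr_ge0 ?exprn_ge0 ?(ltW L0) ?(ltW Dl0) ?(ltW d0) ?(ltW r0).
have YE : Y = Z * y.
  have -> : Z * y = Num.sqrt ((Z * y) ^+ 2).
    by rewrite sqrtr_sqr ger0_norm// mulr_ge0.
  rewrite exprMn yy; congr Num.sqrt.
  by rewrite /Z rr; field; rewrite !gt_eqF.
have h1 : T%:R^-1 * (16 * Dl / (dlt * eta)) <= 2560 * (Z + Y).
  have -> : T%:R^-1 * (16 * Dl / (dlt * eta)) = 16 * Dl / (dlt * T%:R) * eta^-1.
    by field; rewrite !gt_eqF.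
  apply: (@le_trans _ _ (16 * Dl / (dlt * T%:R) * (160 * Q))).
    by rewrite ler_wpM2l// divr_ge0 ?mulr_ge0 ?(ltW Dl0) ?(ltW d0).
  have -> : 16 * Dl / (dlt * T%:R) * (160 * Q) = 2560 * Z * beta^-1.
    by rewrite /Q /Z; field; rewrite !gt_eqF.
  by rewrite bV YE le_eqVlt; apply/orP; left; apply/eqP; ring.
have h2 : beta * s2 / dlt <= Y.
  have -> : beta * s2 / dlt = Z * (y ^+ 2 * beta).
    by rewrite yy /Z; field; rewrite !gt_eqF.
  rewrite YE ler_wpM2l// expr2 -mulrA ler_piMr//.
  by rewrite -(@ler_pM2r _ beta^-1) ?invr_gt0// mulfK ?gt_eqF// mul1r bV lerDr.
have h3 : T%:R^-1 * (32 * beta * s2 / (3 * dlt) * N) <= 64 / 3 * Y.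
  have -> : T%:R^-1 * (32 * beta * s2 / (3 * dlt) * N) =
      32 / 3 * (beta * s2 / dlt) * (N / T%:R).
    by field; rewrite !gt_eqF.
  have NT2 : N / T%:R <= 2 by rewrite ler_pdivrMr.
  have q0 : 0 <= beta * s2 / dlt by rewrite divr_ge0 ?mulr_ge0 ?(ltW b0) ?(ltW d0).
  apply: (@le_trans _ _ (32 / 3 * (beta * s2 / dlt) * 2)).
    by rewrite ler_wpM2l// mulr_ge0.
  lra.
have Y0 : 0 <= Y by exact: sqrtr_ge0.
rewrite mulrDr; lra.
Qed.
End TunedParameters.

Theorem theoremC6 (R : realType) :
  (* (i) *)
  (forall (NL : nat) (m n k : 'I_NL -> nat)
     (dX : measure_display) (Xi : measurableType dX) (D : probability Xi R)
     (f : (pcoord m n -> R) -> R) (gradf : (pcoord m n -> R) -> pcoord m n -> R)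
     (F : (pcoord m n -> R) -> Xi -> R) (G : (pcoord m n -> R) -> Xi -> pcoord m n -> R)
     (L : R) (sig : 'I_NL -> R)
     (dO : measure_display) (Om : measurableType dO) (P : probability Om R)
     (xi : nat -> Om -> Xi) (U : nat -> Om -> {ffun pcoord m n -> bool})
     (x0 : pcoord m n -> R) (beta1 eta : R) (tau : nat),
     is_gradient f gradf ->
     Assumption1 f -> Assumption2 gradf L -> 0 < L ->
     StochObjective D f F G -> Assumption3 D G gradf sig ->
     jointly_measurable G ->
     sampling_model D k P xi U ->
     (forall l, 0 < k l /\ k l < m l * n l)%N ->
     0 < beta1 <= 1 ->
     64 / (3 * beta1 * delta_min m n k) <= tau%:R ->
     0 < eta ->
     eta <= Num.min (Num.min (1 / (4 * L))
                             (Num.sqrt (3 * delta_min m n k * beta1 ^+ 2 / (80 * L ^+ 2))))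
                    (Num.min (Num.sqrt (3 * delta_min m n k / (80 * tau%:R ^+ 2 * L ^+ 2)))
                             (Num.sqrt (3 * beta1 / (16 * tau%:R * L ^+ 2)))) ->
     forall K : nat, (1 <= K)%N ->
       (((K * tau)%:R)^-1%:E *
          \sum_(t < K * tau)
             Egradsq P gradf (gosare_x G xi U x0 beta1 eta tau t)
        <= (16 * Delta f x0 / (delta_min m n k * eta * (K * tau)%:R)
            + 32 * beta1 * sigma2 sig / (3 * delta_min m n k))%:E)%E)
  /\
  (* (ii) *)
  (exists C : R,
   forall (NL : nat) (m n k : 'I_NL -> nat)
     (dX : measure_display) (Xi : measurableType dX) (D : probability Xi R)
     (f : (pcoord m n -> R) -> R) (gradf : (pcoord m n -> R) -> pcoord m n -> R)
     (F : (pcoord m n -> R) -> Xi -> R) (G : (pcoord m n -> R) -> Xi -> pcoord m n -> R)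
     (L : R) (sig : 'I_NL -> R)
     (dO : measure_display) (Om : measurableType dO) (P : probability Om R)
     (xi : nat -> Om -> Xi) (U : nat -> Om -> {ffun pcoord m n -> bool})
     (x0 : pcoord m n -> R) (beta1 eta : R) (tau T : nat),
     is_gradient f gradf ->
     Assumption1 f -> Assumption2 gradf L -> 0 < L ->
     StochObjective D f F G -> Assumption3 D G gradf sig ->
     jointly_measurable G ->
     sampling_model D k P xi U ->
     (forall l, 0 < k l /\ k l < m l * n l)%N ->
     let dlt := delta_min m n k in
     let s2 := sigma2 sig in
     let Dl := Delta f x0 in
     0 < Dl ->
     2 + 128 / (3 * dlt) + (128 ^+ 2 * s2) / (9 * Num.sqrt dlt * L * Dl) <= T%:R ->
     beta1 = (1 + Num.sqrt (dlt * Num.sqrt dlt * s2 * T%:R / (L * Dl)))^-1 ->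
     (tau : int) = Num.ceil (64 / (3 * dlt * beta1)) ->
     eta = (4 * L + Num.sqrt (80 * L ^+ 2 / (3 * dlt * beta1 ^+ 2))
              + Num.sqrt (80 * tau%:R ^+ 2 * L ^+ 2 / (3 * dlt))
              + Num.sqrt (16 * tau%:R * L ^+ 2 / (3 * beta1)))^-1 ->
     ((T%:R)^-1%:E *
        \sum_(t < T) Egradsq P gradf (gosare_x G xi U x0 beta1 eta tau t)
      <= (C * (L * Dl / (dlt ^+ 2 * Num.sqrt dlt * T%:R)
               + Num.sqrt (L * Dl * s2 / (dlt ^+ 3 * Num.sqrt dlt * T%:R))))%:E)%E).
Proof.
split.
- move=> NL m n k dX Xi D f gradf F G L sig dO Om P xi U x0 beta eta tau.
  move=> gf A1 A2 L0 _ A3 mG HS Hk beta01 tau_large eta0.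
  have /andP[d0 d1] := delta_min_gt0_le1 R Hk.
  have /andP[b0 b1] := beta01.
  have t0 : 0 < tau%:R :> R.
    by apply: lt_le_trans tau_large; rewrite divr_gt0 ?mulr_gt0.
  rewrite !le_min => /andP[/andP[e1 e2] /andP[e3 _]] K K1.
  have sq (x : R) : 0 <= x -> eta <= Num.sqrt x -> eta ^+ 2 <= x.
    move=> x_ge0 ex; rewrite -[leRHS]sqr_sqrtr//.
    by rewrite ler_pXn2r ?nnegrE ?sqrtr_ge0 ?(ltW eta0).
  have KT0 : 0 < (K * tau)%:R :> R by rewrite natrM mulr_gt0// ltr0n.
  have H1 : 4 * L * eta <= 1.
    by rewrite mulrC -ler_pdivlMr ?mulr_gt0.
  have H2 : 80 * L ^+ 2 * eta ^+ 2 <= 3 * delta_min m n k * beta ^+ 2.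
    have p0 : 0 < 80 * L ^+ 2 by rewrite mulr_gt0 ?exprn_gt0.
    rewrite mulrC -ler_pdivlMr//; apply: sq => //.
    by rewrite divr_ge0 ?(ltW p0)// mulr_ge0 ?sqr_ge0// mulr_ge0 ?(ltW d0).
  have H3 : 80 * tau%:R ^+ 2 * L ^+ 2 * eta ^+ 2 <= 3 * delta_min m n k.
    have p0 : 0 < 80 * tau%:R ^+ 2 * L ^+ 2 by rewrite !mulr_gt0 ?exprn_gt0.
    rewrite mulrC -ler_pdivlMr//; apply: sq => //.
    by rewrite divr_ge0 ?(ltW p0)// mulr_ge0 ?(ltW d0).
  have H := sum_Egradsq_le x0 gf A1 A2 L0 A3 mG HS Hk beta01 eta0 tau_large
    H1 H2 H3 (leqnn (K * tau)).
  have KV0 : (0 <= ((K * tau)%:R^-1)%:E :> \bar R)%E by rewrite lee_fin invr_ge0 ltW.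
  apply: (le_trans (lee_wpmul2l KV0 H)).
  rewrite -EFinM lee_fin le_eqVlt; apply/orP; left; apply/eqP.
  move: ((K * tau)%:R : R) KT0 => N N0.
  by field; rewrite !gt_eqF.
- exists 2600 => NL m n k dX Xi D f gradf F G L sig dO Om P xi U x0 beta eta tau T.
  move=> gf A1 A2 L0 _ A3 mG HS Hk dlt s2 Dl Dl0 HT betaE tauE etaE.
  have d01 : 0 < dlt <= 1 by exact: delta_min_gt0_le1.
  have s20 : 0 <= s2 by apply: sumr_ge0 => l _; exact: sqr_ge0.
  have beta01 := beta_gt0_le1 betaE.
  have tau_large := tau_ge tauE.
  have tauT := tau_le_T L0 d01 s20 Dl0 HT betaE tauE.
  have eta0 := eta_gt0 L0 etaE.
  have [d0 _] := andP d01; have [b0 _] := andP beta01.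
  have t0 : (0 < tau)%N.
    rewrite -(ltr0n R); apply: lt_le_trans tau_large.
    by rewrite divr_gt0 ?mulr_gt0.
  have T0 : 0 < T%:R :> R by rewrite ltr0n (leq_trans t0).
  (* The last, incomplete block adds at most [tau] steps, hence at most [T] by [tau_le_T]. *)
  pose K := (T %/ tau).+1.
  have H := sum_Egradsq_le x0 gf A1 A2 L0 A3 mG HS Hk beta01 eta0 tau_large
    (eta_le1 L0 etaE) (eta_le2 L0 d01 betaE etaE) (eta_le3 L0 d01 etaE)
    (ltnW (ltn_ceil T t0) : (T <= K * tau)%N).
  have TV0 : (0 <= (T%:R^-1)%:E :> \bar R)%E by rewrite lee_fin invr_ge0 ltW.
  apply: (le_trans (lee_wpmul2l TV0 H)).
  rewrite -EFinM lee_fin.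
  apply: (tuned_rate L0 d01 s20 Dl0 HT betaE tauE etaE).
  rewrite ler0n/= -natrM ler_nat /K mulSn mul2n -addnn leq_add//.
  exact: leq_trunc_div.
Qed.
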